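(* Consider a sequence of linear models $y=X\beta+\varepsilon$ indexed by $n$, with $X=(x_1,\dots,x_p)\in\mathbb{R}^{n\times p}$ deterministic, $\|x_j\|^2=n$ for all $j$, $\beta\in\mathbb{R}^p$, $\varepsilon\sim N(0,\sigma^2I_n)$ (with $p,\beta,\sigma$ and the constants below allowed to depend on $n$). Let $A^o=\{j:\beta_j\ne0\}$, $d^o=|A^o|$, $\beta_*=\min_{j\in A^o}|\beta_j|$, let $w^o$ be the largest diagonal element of $\Sigma_{A^o}^{-1}$, let $\widehat\beta^o=\arg\min_b\{\|y-Xb\|^2:b_j=0\ \forall j\notin A^o\}$, and let $\lambda_{\mathrm{univ}}=\sigma\sqrt{(2/n)\log p}$. Suppose that for a positive integer $d^*$ and $0<c_*\le c^*<\infty$, $$c_*\le \min_{|A|\le d^*}c_{\min}(\Sigma_A)\le\max_{|A|\le d^*}c_{\max}(\Sigma_A)\le c^*,$$ that $d^*/(c^*/c_*+1/2)\ge d^o\to\infty$, that $\gamma\ge c_*^{-1}\sqrt{4+c_*/c^*}$, and that $$\beta_*\ \ge\ \sigma\sqrt{w^o(2/n)\log d^o}+\gamma\max\Big\{2\sqrt{c^*}\,\sigma\sqrt{(2/n)\log\widetilde p_1},\ \lambda_{\mathrm{univ}}\Big\},$$ where $\widetilde p_1$ is defined with $m=d^*-d^o$. Let $\widehat\beta(\lambda)$ be the MC+ selector with regularization parameter $\gamma$. Then $$P\{\widehat\beta(\lambda_{\mathrm{univ}})\ne\widehat\beta^o\ \text{or}\ \mathrm{sgn}(\widehat\beta(\lambda_{\mathrm{univ}}))\ne\mathrm{sgn}(\beta)\}\to0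 .$$
   Context: Notation: $\|\cdot\|$ is the Euclidean norm; $\mathrm{sgn}(t)=I\{t>0\}-I\{t<0\}$, applied componentwise. For $A\subseteq\{1,\dots,p\}$, $X_A=(x_j,j\in A)$ and $\Sigma_A=X_A'X_A/n$; $c_{\min}$, $c_{\max}$ denote smallest and largest eigenvalues. Definition of $\widetilde p_1$: for an integer $1\le m\le p-d^o$, $\widetilde p_1\ge\sqrt e$ is the solution of $2\log\widetilde p_1-1-\log(2\log\widetilde p_1)=(2/m)\log\binom{p-d^o}{m}$. MCP with parameter $\gamma>0$: $\rho(t;\lambda)=\lambda\int_0^t(1-x/(\gamma\lambda))_+\,dx$, $t\ge0$; $\dot\rho(t;\lambda)=\partial\rho(t;\lambda)/\partial t$. Estimating equation: $\lambda\oplus\widehat\beta\in\mathbb{R}^{1+p}$ is a solution if $x_j'(y-X\widehat\beta)/n=\mathrm{sgn}(\widehat\beta_j)\dot\rho(|\widehat\beta_j|;\lambda)$ whenever $\widehat\beta_j\ne0$, and $|x_j'(y-X\widehat\beta)/n|\le\lambda$ whenever $\widehat\beta_j=0$. Solution path: $x\mapsto\lambda^{(x)}\oplus\widehat\beta^{(x)}$, $x\in[0,\infty)$, denotes a continuous path in $\mathbb{R}^{1+p}$ of solutions of the estimating equation with $\widehat\beta^{(0)}=0$ and $\lim_{x\to\infty}\lambda^{(x)}=0$ (for the MCP, such a path exists and is unique up to reparametrization for almost every $(X,y)$). Then $\widehat\beta(\lambda)=\widehat\beta^{(x_\lambda)}$ with $x_\lambda=\inf\{x\ge0:\lambda^{(x)}\le\lambda\}$.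 The MC+ selector is this $\widehat\beta(\lambda)$ when $\rho$ is the MCP. *)

(* Defs.v *)
From HB Require Import structures.
From mathcomp Require Import all_boot all_order all_algebra.
From mathcomp Require Import all_classical all_reals all_analysis.

Set Implicit Arguments.
Unset Strict Implicit.
Unset Printing Implicit Defensive.

Import Order.TTheory GRing.Theory Num.Theory.
Import numFieldNormedType.Exports.

Local Open Scope classical_set_scope.
Local Open Scope ring_scope.

Section LinearModel.
Context {R : realType}.

(* Sum of squared entries: the norm [`|v|] that the library puts on matrices
   is the sup norm, not the Euclidean one. *)
Definition sqnorm (n : nat) (v : 'cV[R]_n) : R := \sum_(i < n) v i 0 ^+ 2.

Definition supp (p : nat) (b : 'cV[R]_p) : {set 'I_p} :=
  [set j | b j 0 != 0]%SET.

Definition sgn (p : nat) (b : 'cV[R]_p) : 'cV[R]_p := map_mx Num.sg b.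

Definition subX (n p : nat) (X : 'M[R]_(n, p)) (A : {set 'I_p}) :
  'M[R]_(n, #|A|) := colsub (fun k : 'I_#|A| => enum_val k) X.

Definition gram (n p : nat) (X : 'M[R]_(n, p)) (A : {set 'I_p}) :
  'M[R]_(#|A|) := n%:R^-1 *: ((subX X A)^T *m subX X A).

(* In the next four definitions [inf] and [sup] are over finite sets, hence are
   the minimum and the maximum as soon as the set is nonempty (and are 0 by
   convention on the empty set). *)
Definition cmin (k : nat) (M : 'M[R]_k) : R := inf [set a | eigenvalue M a].

Definition cmax (k : nat) (M : 'M[R]_k) : R := sup [set a | eigenvalue M a].

Definition beta_min (p : nat) (b : 'cV[R]_p) : R :=
  inf [set `|b j 0| | j in [set j | j \in supp b]].

Definition max_diag_inv (k : nat) (M : 'M[R]_k) : R :=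
  sup [set invmx M i i | i in [set: 'I_k]].

(* The empty submodel has no eigenvalue, so it is left out of the minimum and
   of the maximum over [#|A| <= d]. *)
Definition sparse_eigen_bounds (n p : nat) (X : 'M[R]_(n, p)) (d : nat)
    (clo chi : R) : Prop :=
  forall A : {set 'I_p}, (0 < #|A| <= d)%N ->
    clo <= cmin (gram X A) /\ cmax (gram X A) <= chi.

Definition is_oracle_lse (n p : nat) (X : 'M[R]_(n, p)) (y : 'cV[R]_n)
    (A : {set 'I_p}) (b : 'cV[R]_p) : Prop :=
  (forall j, j \notin A -> b j 0 = 0) /\
  (forall b' : 'cV[R]_p, (forall j, j \notin A -> b' j 0 = 0) ->
     sqnorm (y - X *m b) <= sqnorm (y - X *m b')).

(* The minimizer is unique as soon as the columns indexed by [A] are linearly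
   independent; otherwise this is some minimizer. *)
Definition oracle_lse (n p : nat) (X : 'M[R]_(n, p)) (y : 'cV[R]_n)
    (A : {set 'I_p}) : 'cV[R]_p := xget 0 [set b | is_oracle_lse X y A b].

Definition lambda_univ (n p : nat) (sigma : R) : R :=
  sigma * Num.sqrt (2 / n%:R * ln p%:R).

(* [q] is the tilde-p_1 of parameter [m], for [p] variables of which [d] are
   relevant. *)
Definition is_ptilde1 (p d m : nat) (q : R) : Prop :=
  [/\ (1 <= m <= p - d)%N, Num.sqrt (expR 1) <= q &
      2 * ln q - 1 - ln (2 * ln q) = 2 / m%:R * ln ('C(p - d, m))%:R].

Definition mcp (gamma lambda t : R) : R :=
  lambda * \int[lebesgue_measure]_(x in `[0, t])
             Num.max 0 (1 - x / (gamma * lambda)).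

Definition dmcp (gamma lambda t : R) : R := derive1 (mcp gamma lambda) t.

Definition score (n p : nat) (X : 'M[R]_(n, p)) (y : 'cV[R]_n) (b : 'cV[R]_p)
    (j : 'I_p) : R := ((X^T *m (y - X *m b)) j 0) / n%:R.

Definition estimating_eq (n p : nat) (X : 'M[R]_(n, p)) (y : 'cV[R]_n)
    (gamma lambda : R) (b : 'cV[R]_p) : Prop :=
  forall j : 'I_p,
    (b j 0 != 0 ->
       score X y b j = Num.sg (b j 0) * dmcp gamma lambda `|b j 0|) /\
    (b j 0 = 0 -> `|score X y b j| <= lambda).

(* The path is parametrized by x in [0, +oo); the values of [lam] and [bhat] at
   negative x are irrelevant. *)
Definition solution_path (n p : nat) (X : 'M[R]_(n, p)) (y : 'cV[R]_n)
    (gamma : R) (lam : R -> R) (bhat : R -> 'cV[R]_p) : Prop :=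
  [/\ {within `[0, +oo[, continuous lam},
      {within `[0, +oo[, continuous bhat},
      forall x, 0 <= x -> estimating_eq X y gamma (lam x) (bhat x),
      bhat 0 = 0 &
      lam x @[x --> +oo] --> 0].

Definition selector (p : nat) (lam : R -> R) (bhat : R -> 'cV[R]_p)
    (lambda : R) : 'cV[R]_p :=
  bhat (inf [set x | 0 <= x /\ lam x <= lambda]).

(* The joint law of the coordinates is N(0, sigma^2 I_n): they are N(0, sigma^2)
   and mutually independent; the product rule for subfamilies follows by taking
   some of the [B i] equal to the whole line.  The second parameter of
   [normal_prob] is the standard deviation. *)
Definition gaussian_noise (d : measure_display) (T : measurableType d)
    (P : probability T R) (n : nat) (sigma : R)
    (eps : 'I_n -> {RV P >-> R}) : Prop :=
  (forall i (B : set R), measurable B ->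
     distribution P (eps i) B = normal_prob 0 sigma B) /\
  (forall B : 'I_n -> set R, (forall i, measurable (B i)) ->
     P (\bigcap_(i in [set: 'I_n]) (eps i @^-1` B i)) =
     (\prod_(i < n) P (eps i @^-1` B i))%E).

Definition response (d : measure_display) (T : measurableType d)
    (P : probability T R) (n p : nat) (X : 'M[R]_(n, p)) (beta : 'cV[R]_p)
    (eps : 'I_n -> {RV P >-> R}) (w : T) : 'cV[R]_n :=
  X *m beta + \col_i eps i w.

End LinearModel.

(* Main.v *)
(* Let [A] be the support of [beta], [o] the oracle estimator and [m = d* - #|A|].
   With high probability the scores of [o] off [A] are below [lambda_univ], the
   entries of [o] on [A] are too large to be penalized, and, for each set [B1] of
   [m] indices off [A], the noise is small on the part of the span of [A] and
   [B1] orthogonal to [A].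

   On that event [o] solves the estimating equation at each level between
   [lambda_univ] and the larger level [lambda_2] of the hypothesis on [beta_min],
   and convexity of the penalized loss on sparse vectors makes it the only
   solution with at most [m] nonzero entries off [A].  For levels above
   [lambda_2], a solution cannot have exactly [m] indices off [A] that are active
   (nonzero entry, or score of the size of the level): testing the estimating
   equation against two vectors contradicts the noise bound.  So along the path,
   down to [lambda_univ], having at most [m] nonzero entries off [A] is an open
   and closed condition; it holds at [0], hence at the selected point, which is
   therefore [o].

   The dimension bound tolerates an inflation of the chi-square level by 9/8, so
   that the exponential Markov inequality and a union bound over the sets [B1]
   suffice, by the definition of [tilde p_1].  The quadratic moment generating
   function is reduced to the linear one by Gaussian averaging. *)

(* The MCP is not convex: the estimating equation can have many solutions, and those with more than
   [d] nonzero entries escape the eigenvalue bounds. Only continuity from the zero solution singles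
   out the selected one, whence a condition that cannot be left along the path. An entry can leave
   zero only at an index whose score has reached the level, so the count of active indices at a
   point controls the nonzero entries at nearby points.

   The 9/8 is what makes the union bound converge. With z = 2 ln [tilde p_1], the number of sets
   [B1] times the Chernoff bound at level z is exactly 1, by definition of [tilde p_1]; at level
   9z/8 the exponent gains at least m/2 (1/8 - ln(9/8)), and m >= #|A|/2 tends to infinity.
   Likewise, for k Gaussian variables at level sqrt(2 ln k) the exponential factor alone gives a
   bound of constant order, and convergence comes from the factor 1/x of the Mills bound.

   The path need not depend measurably on the sample point, so the noise conditions are gathered in
   one measurable event that does not mention the path. *)
Require Import Defs.
From HB Require Import structures.
From mathcomp Require Import all_boot all_order all_algebra.
From mathcomp Require Import all_classical all_reals all_analysis.
From mathcomp Require Import measurable_realfun ring lra.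

Set Implicit Arguments.
Unset Strict Implicit.
Unset Printing Implicit Defensive.

Import Order.TTheory GRing.Theory Num.Theory.
Import numFieldNormedType.Exports.

Local Open Scope classical_set_scope.
Local Open Scope ring_scope.

(** * Linear algebra *)

Section Dot.
Context {R : realType}.

Definition dot (n : nat) (u v : 'cV[R]_n) : R := \sum_(i < n) u i 0 * v i 0.

Lemma dot_sqnorm (n : nat) (u : 'cV[R]_n) : sqnorm u = dot u u.
Proof. by apply: eq_bigr => i _; rewrite expr2. Qed.

Lemma dotC (n : nat) (u v : 'cV[R]_n) : dot u v = dot v u.
Proof. by apply: eq_bigr => i _; rewrite mulrC. Qed.

Lemma dotDl (n : nat) (u v w : 'cV[R]_n) : dot (u + v) w = dot u w + dot v w.
Proof. by rewrite -big_split; apply: eq_bigr => i _; rewrite mxE mulrDl. Qed.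

Lemma dotDr (n : nat) (u v w : 'cV[R]_n) : dot w (u + v) = dot w u + dot w v.
Proof. by rewrite dotC dotDl !(dotC w). Qed.

Lemma dotZl (n : nat) (a : R) (u v : 'cV[R]_n) : dot (a *: u) v = a * dot u v.
Proof. by rewrite mulr_sumr; apply: eq_bigr => i _; rewrite mxE mulrA. Qed.

Lemma dotZr (n : nat) (a : R) (u v : 'cV[R]_n) : dot u (a *: v) = a * dot u v.
Proof. by rewrite dotC dotZl dotC. Qed.

Lemma dotNl (n : nat) (u v : 'cV[R]_n) : dot (- u) v = - dot u v.
Proof. by rewrite -scaleN1r dotZl mulN1r. Qed.

Lemma dotNr (n : nat) (u v : 'cV[R]_n) : dot u (- v) = - dot u v.
Proof. by rewrite dotC dotNl dotC. Qed.

Lemma dotBl (n : nat) (u v w : 'cV[R]_n) : dot (u - v) w = dot u w - dot v w.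
Proof. by rewrite dotDl dotNl. Qed.

Lemma dotBr (n : nat) (u v w : 'cV[R]_n) : dot w (u - v) = dot w u - dot w v.
Proof. by rewrite dotDr dotNr. Qed.

Lemma dot0l (n : nat) (u : 'cV[R]_n) : dot 0 u = 0.
Proof. by apply: big1 => i _; rewrite mxE mul0r. Qed.

Lemma dot0r (n : nat) (u : 'cV[R]_n) : dot u 0 = 0.
Proof. by rewrite dotC dot0l. Qed.

Lemma dot_suml (n : nat) (I : Type) (s : seq I) (P : pred I) (F : I -> 'cV[R]_n)
  (u : 'cV[R]_n) :
  dot (\sum_(i <- s | P i) F i) u = \sum_(i <- s | P i) dot (F i) u.
Proof.
apply: (big_morph (fun v => dot v u)); last exact: dot0l.
by move=> v w; exact: dotDl.
Qed.

Lemma dot_mulmx (n p : nat) (M : 'M[R]_(n, p)) (u : 'cV[R]_p) (v : 'cV[R]_n) :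
  dot (M *m u) v = dot u (M^T *m v).
Proof.
have E (m : nat) (a b : 'cV[R]_m) : dot a b = (a^T *m b) 0 0.
  by rewrite mxE; apply: eq_bigr => i _; rewrite mxE.
by rewrite !E trmx_mul mulmxA.
Qed.

Lemma sqnorm_ge0 (n : nat) (u : 'cV[R]_n) : 0 <= sqnorm u.
Proof. by apply: sumr_ge0 => i _; exact: sqr_ge0. Qed.

Lemma sqnorm_eq0 (n : nat) (u : 'cV[R]_n) : (sqnorm u == 0) = (u == 0).
Proof.
apply/eqP/eqP => [|->]; last by rewrite dot_sqnorm dot0l.
move=> /psumr_eq0P H; apply/matrixP => i j; rewrite ord1 mxE.
by apply/eqP; rewrite -sqrf_eq0 H// => k _; exact: sqr_ge0.
Qed.

Lemma sqnormD (n : nat) (u v : 'cV[R]_n) :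
  sqnorm (u + v) = sqnorm u + 2 * dot u v + sqnorm v.
Proof. rewrite !dot_sqnorm !dotDl !dotDr (dotC v u); ring. Qed.

Lemma sqnormZ (n : nat) (a : R) (u : 'cV[R]_n) :
  sqnorm (a *: u) = a ^+ 2 * sqnorm u.
Proof. by rewrite !dot_sqnorm dotZl dotZr mulrA expr2. Qed.

(** Cauchy-Schwarz: the square norm of [sqnorm u *: v - dot u v *: u] is nonnegative and has
    [sqnorm u] as a factor. *)
Lemma dot_sqr_le (n : nat) (u v : 'cV[R]_n) :
  dot u v ^+ 2 <= sqnorm u * sqnorm v.
Proof.
have [->|u0] := eqVneq u 0.
  by rewrite dot0l expr0n/= mulr_ge0 ?sqnorm_ge0.
have su : 0 < sqnorm u by rewrite lt_neqAle eq_sym sqnorm_eq0 u0 sqnorm_ge0.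
have := sqnorm_ge0 (sqnorm u *: v - dot u v *: u).
have -> : sqnorm (sqnorm u *: v - dot u v *: u) =
    sqnorm u * (sqnorm u * sqnorm v - dot u v ^+ 2).
  rewrite !dot_sqnorm !(dotBl, dotBr, dotZl, dotZr) (dotC v u); ring.
by rewrite pmulr_rge0// subr_ge0.
Qed.

End Dot.

(** * Extreme eigenvalues and quadratic forms *)

Section Rayleigh.
Context {R : realType}.

(** The form attains its minimum on the unit sphere by compactness, and a minimizer is an
    eigenvector because the form is stationary there. Row vectors appear because [EVT_min_rV] is
    about them. *)
Lemma sym_form_min_eigen (k : nat) (M : 'M[R]_k.+1) : M^T = M ->
  exists2 a, eigenvalue M a &
    forall v : 'cV[R]_k.+1, a * sqnorm v <= dot v (M *m v).
Proof.
move=> Msym.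
pose q (v : 'rV[R]_k.+1) := \sum_i v 0 i * \sum_j v 0 j * M i j.
pose s (v : 'rV[R]_k.+1) := \sum_i v 0 i * v 0 i.
have cc i : continuous (fun v : 'rV[R]_k.+1 => v 0 i).
  by move=> v; exact: coord_continuous.
have cq : continuous q.
  apply: continuous_big => [|i _]; first exact: add_continuous.
  move=> v; apply: continuousM; first exact: cc.
  apply: continuous_big => [|j _ w]; first exact: add_continuous.
  by apply: continuousM; [exact: cc|exact: cst_continuous].
have cs : continuous s.
  apply: continuous_big => [|i _ v]; first exact: add_continuous.
  by apply: continuousM; exact: cc.
have qE v : q v = dot v^T (M *m v^T).
  apply: eq_bigr => i _; rewrite !mxE; congr *%R.
  by apply: eq_bigr => j _; rewrite !mxE mulrC.
have sE v : s v = sqnorm v^T.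
  by apply: eq_bigr => i _; rewrite !mxE.
pose S := [set v | s v = 1].
have S0 : S !=set0.
  exists (delta_mx 0 0); rewrite /S/= /s (bigD1 ord0)//= big1 => [|i i0].
    by rewrite !mxE !eqxx mulr1 addr0.
  by rewrite !mxE (negbTE i0) andbF mulr0.
have cS : compact S.
  apply: bounded_closed_compact.
    exists 1; split; first exact: num_real.
    move=> r r1 v Sv; rewrite /= [X in X <= _]mx_normrE.
    apply/bigmax_leP; split => [|[i j] _ /=]; first lra.
    rewrite ord1 (le_trans _ (ltW r1))// -(@ler_pXn2r _ 2)// ?nnegrE//.
    rewrite expr1n real_normK ?num_real// -Sv /s (bigD1 j)//= expr2 lerDl.
    by apply: sumr_ge0 => l _; rewrite -expr2 sqr_ge0.
  apply: (@preimage_closed _ _ s [set 1]) => [v _|]; [exact: cs|exact: closed_eq].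
have [c] := EVT_min_rV S0 cS (continuous_subspaceT cq).
rewrite inE => Sc cmin.
have scal v : q c * s v <= q v.
  have [s0|v0] := eqVneq (s v) 0.
    have /eqP : sqnorm v^T == 0 by rewrite -sE s0.
    by rewrite s0 mulr0 qE => /eqP; rewrite sqnorm_eq0 => /eqP ->; rewrite dot0l.
  have sv : 0 < s v by rewrite lt_neqAle eq_sym v0 sE sqnorm_ge0.
  pose a := (Num.sqrt (s v))^-1.
  have a2 : a ^+ 2 = (s v)^-1 by rewrite exprVn sqr_sqrtr// ltW.
  have sa : s (a *: v) = 1 by rewrite sE !linearZ/= sqnormZ -sE a2 mulVf.
  have qa : q (a *: v) = (s v)^-1 * q v.
    by rewrite !qE !linearZ/= dotZl dotZr mulrA -expr2 a2.
  have := cmin (a *: v); rewrite inE => /(_ sa).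
  by rewrite qa ler_pdivlMl// mulrC.
have form u : q c * sqnorm u <= dot u (M *m u).
  by have := scal u^T; rewrite sE (qE u^T) trmxK.
exists (q c) => //; apply/eigenvalueP; exists c; last first.
  by apply: contra_eq_neq Sc => ->; rewrite sE trmx0 dot_sqnorm dot0l eq_sym oner_eq0.
apply: trmx_inj; rewrite trmx_mul Msym linearZ/=.
apply/eqP; rewrite -subr_eq0 -sqnorm_eq0.
(* [r] is the defect of [c^T] as an eigenvector. Moving from [c^T] by [t *: r] gives the nonnegative
   value 2 t N + t^2 K, whose linear term forces N = 0. *)
set r := _ - _; set N := sqnorm r.
pose K := dot r (M *m r) - q c * N.
have K0 : 0 <= K by rewrite subr_ge0 form.
have scT : sqnorm c^T = 1 by rewrite -sE.
have quad t : 0 <= 2 * t * N + t ^+ 2 * K.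
  have := form (c^T + t *: r); rewrite -subr_ge0; congr (0 <= _).
  rewrite sqnormD sqnormZ !(mulmxDr, dotDl, dotDr) -!scalemxAr !(dotZl, dotZr).
  rewrite -(qE c) scT /K -/N.
  have -> : dot c^T (M *m r) = dot r (M *m c^T) by rewrite dotC dot_mulmx Msym.
  have -> : N = dot r (M *m c^T) - q c * dot c^T r.
    by rewrite /N dot_sqnorm {2}/r dotBr dotZr (dotC c^T).
  ring.
(* The optimal t would be -N / K; K + 1 allows K = 0. *)
have := quad (- N / (K + 1)).
have -> : 2 * (- N / (K + 1)) * N + (- N / (K + 1)) ^+ 2 * K =
  - (N ^+ 2 * ((K + 2) / (K + 1) ^+ 2)) by field; rewrite gt_eqF//; lra.
have K1 : 0 < (K + 2) / (K + 1) ^+ 2 by rewrite divr_gt0 ?exprn_gt0//; lra.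
by rewrite oppr_ge0 pmulr_lle0// => N0; rewrite -sqrf_eq0 eq_le N0 sqr_ge0.
Qed.

Lemma sym_form_cmin (k : nat) (M : 'M[R]_k) (a : R) (v : 'cV[R]_k) : M^T = M ->
  a <= cmin M -> a * sqnorm v <= dot v (M *m v).
Proof.
case: k M v => [|k] M v Msym aM.
  by rewrite /dot /sqnorm !big_ord0 mulr0.
have [b Mb form] := sym_form_min_eigen Msym.
apply: le_trans (form v); apply: ler_wpM2r; first exact: sqnorm_ge0.
(* An infimum lies below its members only for a set bounded below; [b] is itself such a bound, by
   the form at an eigenvector. *)
apply: (le_trans aM); apply: ge_inf => //; exists b => d /= /eigenvalueP[w wM w0].
have := form w^T; rewrite -[M in dot _ (M *m _)]Msym -trmx_mul wM linearZ/= dotZr.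
rewrite -dot_sqnorm ler_pM2r// lt_neqAle sqnorm_ge0 eq_sym sqnorm_eq0 andbT.
by apply: contra w0 => /eqP H; rewrite -[w]trmxK H trmx0.
Qed.

Lemma sym_form_cmax (k : nat) (M : 'M[R]_k) (a : R) (v : 'cV[R]_k) : M^T = M ->
  cmax M <= a -> dot v (M *m v) <= a * sqnorm v.
Proof.
move=> Msym Ma; rewrite -lerN2 -mulNr -dotNr -mulNmx.
apply: sym_form_cmin; first by rewrite linearN/= Msym.
rewrite lerNl (le_trans _ Ma)// /cmax /cmin /inf opprK.
rewrite [X in sup X <= _](_ : _ = [set a | eigenvalue M a])//.
apply/seteqP; split => [_ [b /= Mb <-]|b /= Mb].
  case/eigenvalueP: Mb => w wM w0; apply/eigenvalueP; exists w => //.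
  by rewrite scaleNr -wM mulmxN opprK.
exists (- b); last by rewrite opprK.
case/eigenvalueP: Mb => w wM w0; apply/eigenvalueP; exists w => //=.
by rewrite mulmxN wM scaleNr.
Qed.

End Rayleigh.

(** * Sparse submodels of the design *)

Section Design.
Context {R : realType} (n p : nat) (X : 'M[R]_(n, p)).

Definition supported (B : {set 'I_p}) (b : 'cV[R]_p) : Prop :=
  forall j, j \notin B -> b j 0 = 0.

(** [gram X B] is indexed by ['I_#|B|], whereas the proof keeps all vectors in R^p with a condition
    on the support, so that [B] can vary. [embed] and [restrict] pass from one to the other. *)
Definition embed (B : {set 'I_p}) (v : 'cV[R]_#|B|) : 'cV[R]_p :=
  \col_j \sum_(k < #|B| | enum_val k == j) v k 0.

Definition restrict (B : {set 'I_p}) (b : 'cV[R]_p) : 'cV[R]_#|B| :=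
  \col_k b (enum_val k) 0.

Lemma embed_val (B : {set 'I_p}) (v : 'cV[R]_#|B|) k :
  embed v (enum_val k) 0 = v k 0.
Proof.
rewrite mxE (big_pred1 k)// => l /=; apply/eqP/eqP => [|->//].
exact: enum_val_inj.
Qed.

Lemma embed_supported (B : {set 'I_p}) (v : 'cV[R]_#|B|) : supported B (embed v).
Proof.
move=> j jB; rewrite mxE big_pred0// => k; apply: contraNF jB => /eqP <-.
exact: enum_valP.
Qed.

Lemma sum_supported (B : {set 'I_p}) (b : 'cV[R]_p) (F : 'I_p -> R -> R) :
  supported B b -> (forall j, F j 0 = 0) ->
  \sum_j F j (b j 0) = \sum_(k < #|B|) F (enum_val k) (restrict B b k 0).
Proof.
move=> sb F0; rewrite (bigID (fun j => j \in B))/= [X in _ + X]big1 => [|j jB].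
  by rewrite addr0 big_enum_val; apply: eq_bigr => k _; rewrite mxE.
by rewrite sb.
Qed.

Lemma mulmx_restrict (B : {set 'I_p}) (b : 'cV[R]_p) :
  supported B b -> X *m b = subX X B *m restrict B b.
Proof.
move=> sb; apply/matrixP => i k; rewrite ord1 !mxE.
rewrite (sum_supported (F := fun j t => X i j * t) sb) => [|j]; last by rewrite mulr0.
by apply: eq_bigr => j _; rewrite !mxE.
Qed.

Lemma sqnorm_restrict (B : {set 'I_p}) (b : 'cV[R]_p) :
  supported B b -> sqnorm (restrict B b) = sqnorm b.
Proof.
move=> sb; rewrite [RHS](sum_supported (F := fun _ t => t ^+ 2) sb)// => j.
by rewrite expr0n.
Qed.

Lemma gram_sym (B : {set 'I_p}) : (gram X B)^T = gram X B.
Proof. by rewrite linearZ/= trmx_mul trmxK. Qed.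

Lemma gram_form (B : {set 'I_p}) (v : 'cV[R]_#|B|) :
  dot v (gram X B *m v) = n%:R^-1 * sqnorm (subX X B *m v).
Proof.
by rewrite /gram -scalemxAl dotZr -mulmxA dotC dot_mulmx trmxK -dot_sqnorm.
Qed.

Section SparseRiesz.
Context (d : nat) (clo chi : R).
Hypothesis clo_gt0 : 0 < clo.
Hypothesis src : sparse_eigen_bounds X d clo chi.

Lemma src_lower (B : {set 'I_p}) (b : 'cV[R]_p) : (#|B| <= d)%N ->
  supported B b -> clo * sqnorm b <= sqnorm (X *m b) / n%:R.
Proof.
move=> Bd sb; have [B0|B0] := posnP #|B|.
  have -> : b = 0.
    apply/matrixP => j k; rewrite ord1 mxE sb//.
    by move/eqP: B0; rewrite cards_eq0 => /eqP ->; rewrite inE.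
  by rewrite mulmx0 !dot_sqnorm !dot0l mulr0 mul0r.
have B0d : (0 < #|B| <= d)%N by rewrite B0.
have [lo _] := src B0d.
rewrite (mulmx_restrict sb) -(sqnorm_restrict sb) [leRHS]mulrC -gram_form.
exact: sym_form_cmin (gram_sym B) lo.
Qed.

Lemma src_upper (B : {set 'I_p}) (b : 'cV[R]_p) : (#|B| <= d)%N ->
  supported B b -> sqnorm (X *m b) / n%:R <= chi * sqnorm b.
Proof.
move=> Bd sb; have [B0|B0] := posnP #|B|.
  have -> : b = 0.
    apply/matrixP => j k; rewrite ord1 mxE sb//.
    by move/eqP: B0; rewrite cards_eq0 => /eqP ->; rewrite inE.
  by rewrite mulmx0 !dot_sqnorm !dot0l mulr0 mul0r.
have B0d : (0 < #|B| <= d)%N by rewrite B0.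
have [_ hi] := src B0d.
rewrite (mulmx_restrict sb) -(sqnorm_restrict sb) [leLHS]mulrC -gram_form.
exact: sym_form_cmax (gram_sym B) hi.
Qed.

(** A kernel vector, extended by zero, has a vanishing form, so it is zero by [src_lower]. *)
Lemma gram_unit (B : {set 'I_p}) : (#|B| <= d)%N -> gram X B \in unitmx.
Proof.
move=> Bd; rewrite -row_free_unit -kermx_eq0; apply/eqP/row_matrixP => k.
rewrite row0; set u := row k _.
have uG : u *m gram X B = 0 by apply/sub_kermxP; exact: row_sub.
pose b := embed u^T.
have rb : restrict B b = u^T.
  by apply/matrixP => i j; rewrite ord1 mxE embed_val.
have sb : supported B b by exact: embed_supported.
have := src_lower Bd sb.
rewrite (mulmx_restrict sb) mulrC [_ / _]mulrC -gram_form rb.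
rewrite -[gram X B]gram_sym -trmx_mul uG trmx0 dot0r -(sqnorm_restrict sb) rb.
rewrite pmulr_lle0// => u0; apply: trmx_inj; apply/eqP.
by rewrite trmx0 -sqnorm_eq0 eq_le u0 sqnorm_ge0.
Qed.

(** Solution of the normal equations on [B] with right-hand side [t]. According to [t] it gives the
    oracle estimator, the regression of a column on [A], the representer of a coordinate, and the
    test vectors of the dimension bound. *)
Definition nsolve (B : {set 'I_p}) (t : 'cV[R]_p) : 'cV[R]_p :=
  embed (invmx (gram X B) *m restrict B t).

Lemma nsolve_supported (B : {set 'I_p}) (t : 'cV[R]_p) :
  supported B (nsolve B t).
Proof. exact: embed_supported. Qed.

Lemma nsolveP (B : {set 'I_p}) (t : 'cV[R]_p) j : (#|B| <= d)%N -> j \in B ->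
  (X^T *m (X *m nsolve B t)) j 0 / n%:R = t j 0.
Proof.
move=> Bd jB; rewrite -(enum_rankK_in jB jB); set k := enum_rank_in _ _.
rewrite /nsolve; set v := invmx (gram X B) *m restrict B t.
have sv := @embed_supported B v.
have rv : restrict B (embed v) = v.
  by apply/matrixP => i l; rewrite ord1 mxE embed_val.
transitivity ((gram X B *m v) k 0); last by rewrite mulKVmx ?gram_unit// mxE.
rewrite (mulmx_restrict sv) rv /gram -scalemxAl -mulmxA mxE [RHS]mxE mulrC.
by congr (_ * _); rewrite [RHS]mxE; apply: eq_bigr => i _; rewrite !mxE.
Qed.

Lemma nsolve_delta_le (B : {set 'I_p}) j : j \in B ->
  nsolve B (delta_mx j 0) j 0 <= max_diag_inv (gram X B).
Proof.
move=> jB; rewrite -{2}(enum_rankK_in jB jB) embed_val.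
set k := enum_rank_in _ _.
have -> : restrict B (delta_mx j 0) = delta_mx k 0 :> 'cV[R]_#|B|.
  apply/matrixP => i l; rewrite ord1 !mxE !eqxx !andbT; congr (_%:R).
  by rewrite -{1}(enum_rankK_in jB jB) (inj_eq enum_val_inj).
rewrite -colE mxE; apply: ub_le_sup; last by exists k.
exists (\sum_i `|invmx (gram X B) i i|) => _ [i _ <-].
rewrite (bigD1 i)//= (le_trans (ler_norm _))// lerDl.
by apply: sumr_ge0.
Qed.

End SparseRiesz.
End Design.

(** * The dimension bound *)

Section Arithmetic.
Context {R : realFieldType}.
Implicit Types u v w c e f g q r s z chi clo M Q G W E D : R.

(** AM-GM: sqrt(v w) <= v + w / 4. It makes the noise bound linear at the cost of a quarter of the
    energy of the test vector. *)
Fact le_of_sqr_le_mul u v w : u ^+ 2 <= v * w -> 0 <= v -> 0 <= w ->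
  u <= w / 4 + v.
Proof.
move=> uvw v0 w0; case: (leP u 0) => [|u0]; first lra.
rewrite -ler_sqr ?nnegrE ?(ltW u0)//; last lra.
by apply: (le_trans uvw); have := sqr_ge0 (w / 4 - v); lra.
Qed.

Fact dim_arith0 u w s1 s2 : w <= s2 -> u <= s1 -> u - 2 * s2 + w <= s1 - s2.
Proof. lra. Qed.

Fact dim_arith1 q g f r e c1 s1 s2 : f + r + g <= f / 4 + e -> c1 <= s1 ->
  9 / 4 * q + s2 <= 9 / 4 * f + 3 * r + c1 ->
  3 / 4 * q + g <= (s1 - s2) / 3 + e.
Proof. lra. Qed.

(** Young's inequality for u = (u + v) - v, with factors 1 + 2 and 1 + 1/2. *)
Fact sqr_le_weighted u v w1 w2 : (u + v) ^+ 2 <= w1 -> v ^+ 2 <= w2 ->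
  u ^+ 2 <= 3 * w1 + 3 / 2 * w2.
Proof. by move=> h1 h2; have := sqr_ge0 (u + 3 / 2 * v); lra. Qed.

(* The slack comes from [z <= 1]: the right-hand side of the first bound is at
   most [59/96 M], short of the [3/4 M] that the left-hand sides add up to. *)
Fact dim_arith2 chi clo z M Q G W E D : 0 < chi -> 0 < clo -> z * chi = clo ->
  z <= 1 -> 0 < M ->
  3 / 4 * Q / chi + G <= D / 3 + E ->
  Q / chi + 2 * G + clo * W <= 3 * E + 3 / 2 * D ->
  E * chi <= 9 / 32 * M -> chi * D <= (1 - z / 2) * M ->
  (3 / 4 + z / 4) * M <=
    (3 / 4 + z / 4) * Q + (chi + clo / 2) * G + clo ^+ 2 / 4 * W ->
  False.
Proof.
move=> chi0 clo0 zc z1 M0 b1 b2 bE bD low.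
have z0 : 0 < z by rewrite -(pmulr_lgt0 _ chi0) zc.
have c0 : chi != 0 by rewrite gt_eqF.
(* The first bound is taken with weight [chi] and the second with weight [clo / 4]: the left-hand
   sides then add up to the right-hand side of [low]. *)
have I1 : 3 / 4 * Q + chi * G <= chi * D / 3 + E * chi.
  have := ler_wpM2l (ltW chi0) b1.
  have -> : chi * (3 / 4 * Q / chi + G) = 3 / 4 * Q + chi * G by field.
  by lra.
have I2 : z / 4 * Q + clo / 2 * G + clo ^+ 2 / 4 * W <=
    z / 4 * (3 * (E * chi) + 3 / 2 * (chi * D)).
  have clo4 : 0 <= clo / 4 by lra.
  have := ler_wpM2l clo4 b2; rewrite -zc.
  have -> : z * chi / 4 * (Q / chi + 2 * G + z * chi * W) =
    z / 4 * Q + z * chi / 2 * G + (z * chi) ^+ 2 / 4 * W by field.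
  by lra.
have I3 : z / 4 * (3 * (E * chi) + 3 / 2 * (chi * D)) <=
    z / 4 * (3 * (9 / 32 * M) + 3 / 2 * ((1 - z / 2) * M)).
  by apply: ler_wpM2l; lra.
have I4 : (3 / 4 + z / 4) * M <= M * (1 / 3 - z / 6 + 9 / 32 +
    z / 4 * (27 / 32 + 3 / 2 - 3 / 4 * z)) by lra.
have := I4; rewrite mulrC ler_pM2l// => I5.
(* What is left is 72 z^2 - 65 z + 52 <= 0, a quadratic with positive minimum at 65/144, close to
   9/20. *)
by have := sqr_ge0 (z - 9 / 20); lra.
Qed.

(** For z k = 1 one has (1 - z/2)(k - 1/2) = k - 1 + z/4. With k = [chi / clo], this is where the
    sparsity condition on [d] bounds the contribution of the scores on [A]. *)
Fact dim_arith3 (k z a m : R) : z * k = 1 -> 0 < z -> z <= 1 -> 0 <= a ->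
  (k - 2^-1) * a <= m -> a * (k - 1) <= (1 - z / 2) * m.
Proof.
move=> zk z0 z1 a0 am.
have z2 : 0 <= 1 - z / 2 by lra.
apply: le_trans (ler_wpM2l z2 am).
have -> : (1 - z / 2) * ((k - 2^-1) * a) = (k - 2^-1 - z * k / 2 + z / 4) * a.
  by field.
by rewrite zk mulrC ler_wpM2r//; lra.
Qed.

End Arithmetic.

Section DimensionBound.
Context {R : realType} (n p : nat) (X : 'M[R]_(n, p)).
Context (d : nat) (clo chi : R).
Hypothesis clo_gt0 : 0 < clo.
Hypothesis chi_gt0 : 0 < chi.
Hypothesis src : sparse_eigen_bounds X d clo chi.

Definition proj (B : {set 'I_p}) (b : 'cV[R]_p) : 'cV[R]_p :=
  \col_j if j \in B then b j 0 else 0.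

Lemma proj_supported (B : {set 'I_p}) (b : 'cV[R]_p) : supported B (proj B b).
Proof. by move=> j jB; rewrite mxE (negbTE jB). Qed.

Lemma supportedS (B C : {set 'I_p}) (b : 'cV[R]_p) :
  B \subset C -> supported B b -> supported C b.
Proof. by move=> /fintype.subsetP BC sb j jC; apply: sb; apply: contra jC => /BC. Qed.

Lemma supportedD (B : {set 'I_p}) (a b : 'cV[R]_p) :
  supported B a -> supported B b -> supported B (a + b).
Proof. by move=> sa sb j jB; rewrite mxE sa// sb// addr0. Qed.

Lemma supportedZ (B : {set 'I_p}) (t : R) (b : 'cV[R]_p) :
  supported B b -> supported B (t *: b).
Proof. by move=> sb j jB; rewrite mxE sb// mulr0. Qed.

Lemma supportedB (B : {set 'I_p}) (a b : 'cV[R]_p) :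
  supported B a -> supported B b -> supported B (a - b).
Proof.
by move=> sa sb; rewrite -scaleN1r; apply/supportedD/supportedZ.
Qed.

(** With S = X'X/n, [gdot a b] is a'Sb and [corr a] is S a. *)
Definition gdot (a b : 'cV[R]_p) : R := dot (X *m a) (X *m b) / n%:R.

Definition corr (a : 'cV[R]_p) : 'cV[R]_p := n%:R^-1 *: (X^T *m (X *m a)).

Lemma gdotC a b : gdot a b = gdot b a.
Proof. by rewrite /gdot dotC. Qed.

Lemma gdotDl a b c : gdot (a + b) c = gdot a c + gdot b c.
Proof. by rewrite /gdot mulmxDr dotDl mulrDl. Qed.

Lemma gdotZl t a b : gdot (t *: a) b = t * gdot a b.
Proof. by rewrite /gdot linearZ/= dotZl mulrA. Qed.

Lemma gdotDr a b c : gdot c (a + b) = gdot c a + gdot c b.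
Proof. by rewrite !(gdotC c) gdotDl. Qed.

Lemma gdotZr t a b : gdot b (t *: a) = t * gdot b a.
Proof. by rewrite !(gdotC b) gdotZl. Qed.

Lemma gdotNr a b : gdot b (- a) = - gdot b a.
Proof. by rewrite -scaleN1r gdotZr mulN1r. Qed.

Lemma corrD a b : corr (a + b) = corr a + corr b.
Proof. by rewrite /corr !mulmxDr scalerDr. Qed.

Lemma corrZ t a : corr (t *: a) = t *: corr a.
Proof. by rewrite /corr -!scalemxAr !scalerA mulrC. Qed.

Lemma gdot_corr a b : gdot a b = dot (corr a) b.
Proof. by rewrite /corr dotZl [LHS]mulrC /gdot dotC dot_mulmx dotC. Qed.

Lemma gdot_sqnorm a : gdot a a = sqnorm (X *m a) / n%:R.
Proof. by rewrite dot_sqnorm. Qed.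

Lemma gdot_ge0 a : 0 <= gdot a a.
Proof. by rewrite gdot_sqnorm divr_ge0// sqnorm_ge0. Qed.

Lemma gdot_sqr_le a b : gdot a b ^+ 2 <= gdot a a * gdot b b.
Proof.
rewrite !gdot_sqnorm /gdot mulrACA -invfM expr_div_n -expr2.
by rewrite ler_wpM2r ?dot_sqr_le// invr_ge0 sqr_ge0.
Qed.

Lemma dot_supported (B : {set 'I_p}) (t u b : 'cV[R]_p) : supported B b ->
  {in B, forall j, t j 0 = u j 0} -> dot t b = dot u b.
Proof.
move=> sb tu; apply: eq_bigr => j _; have [/tu->//|jB] := boolP (j \in B).
by rewrite sb// !mulr0.
Qed.

Lemma corr_nsolve (B : {set 'I_p}) t : (#|B| <= d)%N ->
  {in B, forall j, corr (nsolve X B t) j 0 = t j 0}.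
Proof.
by move=> Bd j jB; rewrite mxE mulrC (nsolveP clo_gt0 src).
Qed.

Lemma gdot_nsolve (B : {set 'I_p}) t b : (#|B| <= d)%N -> supported B b ->
  gdot (nsolve X B t) b = dot t b.
Proof. by move=> Bd sb; rewrite gdot_corr; exact: (dot_supported sb (corr_nsolve t Bd)). Qed.

(** The energy of [a] equals [dot t a]; Cauchy-Schwarz and [clo * sqnorm a <= gdot a a] then allow
    one factor [gdot a a] to be cancelled. *)
Lemma gdot_nsolve_le (B : {set 'I_p}) t : (#|B| <= d)%N ->
  gdot (nsolve X B t) (nsolve X B t) <= sqnorm t / clo.
Proof.
move=> Bd; set a := nsolve X B t.
have sa : supported B a by exact: nsolve_supported.
have Na : gdot a a = dot t a by rewrite gdot_nsolve.
have lo : clo * sqnorm a <= gdot a a.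
  by rewrite gdot_sqnorm; exact: (src_lower src Bd sa).
have := dot_sqr_le t a; rewrite -Na => cs.
have := gdot_ge0 a; rewrite le_eqVlt => /orP[/eqP <-|a0].
  by rewrite divr_ge0 ?sqnorm_ge0// ltW.
rewrite ler_pdivlMr// -(ler_pM2r a0) mulrAC -expr2.
apply: (@le_trans _ _ (sqnorm t * (clo * sqnorm a))).
  by rewrite mulrCA mulrC ler_wpM2l// ltW.
by rewrite ler_wpM2l ?sqnorm_ge0.
Qed.

(** Dual to [gdot_nsolve_le]: here [sqnorm t] equals [gdot a t], and Cauchy-Schwarz for [gdot] meets
    the upper eigenvalue bound at [t]. *)
Lemma sqnorm_le_gdot (B : {set 'I_p}) a t : (#|B| <= d)%N -> supported B a ->
  supported B t -> {in B, forall j, corr a j 0 = t j 0} ->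
  sqnorm t <= chi * gdot a a.
Proof.
move=> Bd sa st at_.
have tt : sqnorm t = gdot a t.
  by rewrite gdot_corr dot_sqnorm; apply/esym; exact: (dot_supported st at_).
have hi : gdot t t <= chi * sqnorm t.
  by rewrite gdot_sqnorm; exact: (src_upper src Bd st).
have := gdot_sqr_le a t; rewrite -tt => cs.
have := sqnorm_ge0 t; rewrite le_eqVlt => /orP[/eqP <-|t0].
  by rewrite mulr_ge0 ?gdot_ge0// ltW.
rewrite -(ler_pM2r t0) -expr2; apply: (le_trans cs).
have -> : chi * gdot a a * sqnorm t = gdot a a * (chi * sqnorm t) by ring.
by apply: ler_wpM2l hi; exact: gdot_ge0.
Qed.

(** An active index has a large score [s] or a large entry [b], and the bound covers all
    intermediate cases, with equality at s = lam, b = 0. Since clo b >= 2 (lam - s), the right-hand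
    side is at least (3/4 + z/4) s^2 + 3 s (lam - s) + (lam - s)^2. *)
Lemma dim_pointwise (lam gamma s b z : R) : 0 < lam -> 2 <= gamma * clo ->
  clo <= chi -> z * chi = clo -> 0 <= s <= lam -> 0 <= b ->
  lam <= s + b / gamma ->
  (3 / 4 + z / 4) * lam ^+ 2 <=
    (3 / 4 + z / 4) * s ^+ 2 + (chi + clo / 2) * (s * b) + clo ^+ 2 / 4 * b ^+ 2.
Proof.
move=> lam0 gc cc zc /andP[s0 sl] b0 lb.
have g0 : 0 < gamma by rewrite -(pmulr_lgt0 _ clo_gt0); lra.
have cb : 2 * (lam - s) <= clo * b.
  have : gamma * (lam - s) <= b by rewrite mulrC -ler_pdivlMr//; lra.
  move=> /(ler_wpM2l (ltW clo_gt0)); apply: le_trans.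
  by rewrite mulrA (mulrC clo) ler_wpM2r//; lra.
have z0 : 0 < z by rewrite -(pmulr_lgt0 _ chi_gt0) zc.
have z1 : z <= 1 by rewrite -(ler_pM2r chi_gt0) zc mul1r.
have h1 : (lam - s) ^+ 2 <= clo ^+ 2 / 4 * b ^+ 2.
  have -> : clo ^+ 2 / 4 * b ^+ 2 = (clo * b / 2) ^+ 2 by field.
  by rewrite ler_sqr ?nnegrE//; lra.
have h2 : 3 * (s * (lam - s)) <= (chi + clo / 2) * (s * b).
  have e1 : s * (2 * (lam - s)) <= s * (clo * b) by rewrite ler_wpM2l.
  have e2 : clo * (s * b) <= chi * (s * b) by rewrite ler_wpM2r// mulr_ge0.
  rewrite mulrDl; lra.
apply: (@le_trans _ _ ((3 / 4 + z / 4) * s ^+ 2 + 3 * (s * (lam - s)) + (lam - s) ^+ 2)); last by lra.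
rewrite -subr_ge0.
have -> : (3 / 4 + z / 4) * s ^+ 2 + 3 * (s * (lam - s)) + (lam - s) ^+ 2 -
  (3 / 4 + z / 4) * lam ^+ 2 = (lam - s) * ((1 - z) / 4 * lam + (5 - z) / 4 * s) by field.
apply: mulr_ge0; first lra.
by apply: addr_ge0; apply: mulr_ge0 => //; lra.
Qed.

Section DimensionClaim.
Context (A B1 : {set 'I_p}) (lam gamma E : R) (b : 'cV[R]_p) (y : 'cV[R]_n).
Let B := A :|: B1.
Let s : 'cV[R]_p := \col_j score X y b j.
Hypothesis AB1 : forall j, j \in A -> j \notin B1.
Hypothesis Bd : (#|B| <= d)%N.
Hypothesis B1_gt0 : (0 < #|B1|)%N.
Hypothesis lo_hi : clo <= chi.
Hypothesis B1_ge : (chi / clo - 2^-1) * #|A|%:R <= #|B1|%:R.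
Hypothesis gamma_clo : 2 <= gamma * clo.
Hypothesis lam_gt0 : 0 < lam.
Hypothesis b_supp : supported B b.
Hypothesis score_A : forall j, j \in A -> `|score X y b j| <= lam.
Hypothesis score_B1 : forall j, j \in B1 ->
  [/\ `|score X y b j| <= lam, lam <= `|score X y b j| + `|b j 0| / gamma &
      score X y b j * b j 0 = `|score X y b j| * `|b j 0|].
Hypothesis noise : forall z, supported B z -> {in A, forall j, corr z j 0 = 0} ->
  (dot (X *m z) y / n%:R) ^+ 2 <= E * gdot z z.
Hypothesis E_ge0 : 0 <= E.
Hypothesis E_le : E * chi <= 9 / 32 * (#|B1|%:R * lam ^+ 2).

Let sE j : s j 0 = score X y b j. Proof. by rewrite mxE. Qed.
Let AB : A \subset B. Proof. exact: finset.subsetUl. Qed.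
Let B1B : B1 \subset B. Proof. exact: finset.subsetUr. Qed.
Let A_d : (#|A| <= d)%N. Proof. exact: leq_trans (subset_leq_card AB) Bd. Qed.

Let t1 := proj B1 s.
Let tA := proj A s.
Let a := nsolve X B t1.
Let c := nsolve X B tA.

Let t1A j : j \in A -> t1 j 0 = 0.
Proof. by move=> /AB1 jA; rewrite mxE (negbTE jA). Qed.

(** Tested against vectors supported by [B], the response acts as X(a + c + b): the score of [b] is
    [t1 + tA] on [B], and [a], [c] represent its two parts. *)
Let score_eq z : supported B z ->
  dot (X *m z) y / n%:R = gdot z a + gdot z c + gdot z b.
Proof.
move=> sz; rewrite (gdotC z a) (gdotC z c) !(gdot_nsolve _ Bd sz) -dotDl.
have -> : dot (t1 + tA) z = dot s z.
  apply: (dot_supported sz) => j; rewrite !mxE inE.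
  by case: (boolP (j \in A)) => [/AB1/negbTE->|_ /= ->];
    rewrite ?add0r ?addr0.
have -> : dot s z = dot (X *m z) (y - X *m b) / n%:R.
  rewrite dot_mulmx [RHS]mulr_suml; apply: eq_bigr => j _.
  by rewrite [s j 0]mxE /score mulrC mulrA.
by rewrite dotBr mulrBl /gdot addrNK.
Qed.

Let F := gdot a a.
Let G := dot t1 b.
Let Q := sqnorm t1.
Let W := sqnorm (proj B1 b).
Let SA := sqnorm tA.
(** The price of the scores on [A]: it bounds the energy of [c - chi^-1 *: tA]. *)
Let D := SA * (clo^-1 - chi^-1).

Let sa : supported B a. Proof. exact: nsolve_supported. Qed.
Let sc : supported B c. Proof. exact: nsolve_supported. Qed.
Let st1 : supported B t1. Proof. exact: supportedS B1B (@proj_supported _ _). Qed.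
Let stA : supported B tA. Proof. exact: supportedS AB (@proj_supported _ _). Qed.

Let t1tA : dot t1 tA = 0.
Proof.
apply: big1 => j _; rewrite [tA j 0]mxE.
by case: ifP => [/t1A ->|_]; rewrite ?mul0r ?mulr0.
Qed.

Let aA : {in A, forall j, corr a j 0 = 0}.
Proof.
by move=> j jA; rewrite (corr_nsolve _ Bd) ?t1A//; exact: (fintype.subsetP AB).
Qed.

(* The noise bound at [z = a]. *)
Let noise_bound_solve : 3 / 4 * Q / chi + G <= D / 3 + E.
Proof.
have aB : gdot a b = G by rewrite (gdot_nsolve _ Bd b_supp).
have := noise sa aA; rewrite score_eq// aB -/F; set P := gdot a c => ns.
have F0 : 0 <= F by exact: gdot_ge0.
have {ns} nsl : F + P + G <= F / 4 + E by exact: le_of_sqr_le_mul ns _ _.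
have C_le : gdot c c <= SA / clo by exact: gdot_nsolve_le.
(* The factor 3/2 makes the energy 9/4 F + 3 P + [gdot c c], whose first two terms are three times
   the 3/4 F + P left in [nsl]; the sign of the cross term P is thus irrelevant. *)
pose z := (3 / 2) *: a + c.
have sz : supported B z by apply: supportedD => //; exact: supportedZ.
have st : supported B ((3 / 2) *: t1 + tA).
  by apply: supportedD => //; exact: supportedZ.
have /(_ _ sz st) := @sqnorm_le_gdot B z _ Bd.
have -> : sqnorm ((3 / 2) *: t1 + tA) = 9 / 4 * Q + SA.
  by rewrite sqnormD dotZl t1tA sqnormZ -/Q -/SA; field.
have -> : gdot z z = 9 / 4 * F + 3 * P + gdot c c.
  by rewrite !(gdotDl, gdotDr, gdotZl, gdotZr) (gdotC c a) -/F -/P; field.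
have ct : {in B, forall j, corr z j 0 = ((3 / 2) *: t1 + tA) j 0}.
  move=> j jB; have ca := corr_nsolve t1 Bd jB; have cc := corr_nsolve tA Bd jB.
  rewrite corrD corrZ [LHS]mxE [X in X + _ = _]mxE ca cc [RHS]mxE.
  by rewrite [X in _ = X + _]mxE.
move=> /(_ ct); rewrite [leRHS]mulrC -ler_pdivrMr// mulrDl => key.
by rewrite /D mulrBr -mulrA; apply: dim_arith1 nsl C_le _; rewrite mulrA.
Qed.

(* The noise bound at [z = a + e], with [e] the part of [b] that is orthogonal
   to the columns in [A]. *)
Let noise_bound_full : Q / chi + 2 * G + clo * W <= 3 * E + 3 / 2 * D.
Proof.
pose th := nsolve X A (corr b).
have sth : supported A th by exact: nsolve_supported.
pose e := b - th; pose z := a + e.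
have sthB : supported B th := supportedS AB sth.
have se : supported B e by exact: supportedB.
have sz : supported B z by exact: supportedD.
have zA : {in A, forall j, corr z j 0 = 0}.
  move=> j jA; rewrite /z /e -scaleN1r !corrD corrZ.
  rewrite [LHS]mxE aA// add0r [LHS]mxE [X in _ + X]mxE.
  by rewrite (corr_nsolve _ A_d)// mulN1r subrr.
have zort w : supported A w -> gdot z w = 0.
  move=> sw; rewrite gdot_corr (dot_supported (u := 0) sw) ?dot0l// => j jA.
  by rewrite zA// mxE.
(* As [z] is orthogonal to the columns in [A], subtracting a multiple of [tA] does not change its
   product with [c], while the energy bound drops from [SA / clo] to [D]. *)
pose h := c - chi^-1 *: tA.
have sAtA : supported A tA by exact: proj_supported.
have hh : gdot h h <= D.
  have C_le : gdot c c <= SA / clo by exact: gdot_nsolve_le.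
  have ct : gdot c tA = SA by rewrite (gdot_nsolve _ Bd)// -dot_sqnorm.
  have tt : gdot tA tA <= chi * SA by rewrite gdot_sqnorm; exact: (src_upper src A_d).
  have -> : gdot h h = gdot c c - 2 * chi^-1 * SA + chi^-1 ^+ 2 * gdot tA tA.
    rewrite /h -scaleN1r scalerA !(gdotDl, gdotDr, gdotZl, gdotZr).
    by rewrite (gdotC tA c) ct; ring.
  have : chi^-1 ^+ 2 * gdot tA tA <= chi^-1 ^+ 2 * (chi * SA).
    by rewrite ler_wpM2l// sqr_ge0.
  have -> : chi^-1 ^+ 2 * (chi * SA) = chi^-1 * SA by field; rewrite gt_eqF.
  rewrite -mulrA => h1; rewrite /D mulrBr (mulrC SA chi^-1).
  exact: dim_arith0.
set V := gdot z z.
have V0 : 0 <= V by exact: gdot_ge0.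
have VE : V <= 3 * E + 3 / 2 * D.
  have := noise sz zA; rewrite score_eq// -/V.
  have -> : gdot z a + gdot z c + gdot z b = V + gdot z h.
    have ze : gdot z e = gdot z b by rewrite gdotDr gdotNr (zort th)// subr0.
    have zh : gdot z h = gdot z c.
      by rewrite gdotDr gdotNr gdotZr (zort tA)// mulr0 subr0.
    have Vz : V = gdot z a + gdot z b by rewrite -ze -gdotDr.
    by rewrite zh Vz addrAC.
  set i := gdot z h => ns.
  have ii : i ^+ 2 <= V * D.
    by apply: le_trans (gdot_sqr_le z h) _; rewrite ler_wpM2l.
  have : V ^+ 2 <= V * (3 * E + 3 / 2 * D).
    have -> : V * (3 * E + 3 / 2 * D) = 3 * (E * V) + 3 / 2 * (V * D) by ring.
    exact: sqr_le_weighted ns ii.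
  move: V0; rewrite le_eqVlt => /orP[/eqP <- _|V0]; last by rewrite expr2 ler_pM2l.
  have D0 : 0 <= D := le_trans (gdot_ge0 h) hh.
  by apply: addr_ge0; apply: mulr_ge0 => //; exact: divr_ge0.
apply: le_trans VE.
(* The cross term is G because [t1] vanishes on [A], where [b - e] is supported. *)
have -> : V = F + 2 * G + gdot e e.
  have ae : gdot a e = G.
    rewrite (gdot_nsolve _ Bd se) /e dotBr [X in _ - X](dot_supported (u := 0) sth).
      by rewrite dot0l subr0.
    by move=> j jA; rewrite t1A// mxE.
  rewrite /V /z gdotDl (gdotDr a e a) (gdotDr a e e) (gdotC e a) ae -/F; ring.
rewrite lerD//; [rewrite lerD//|].
  rewrite ler_pdivrMr// mulrC; apply: (sqnorm_le_gdot Bd sa st1).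
  exact: corr_nsolve.
have le_e : clo * sqnorm e <= gdot e e.
  by rewrite gdot_sqnorm; exact: (src_lower src Bd se).
apply: le_trans le_e; rewrite ler_pM2l//; apply: ler_sum => j _.
rewrite mxE; case: ifP => [jB1|_]; last by rewrite expr0n sqr_ge0.
rewrite [e j 0]mxE [X in _ + X]mxE sth ?oppr0 ?addr0//.
by apply: contraL jB1; exact: AB1.
Qed.

(** Summed over [B1], [dim_pointwise] bounds from below a combination of Q, G and W that the two
    noise bounds make too small. *)
Lemma dimension_bound : False.
Proof.
pose M := #|B1|%:R * lam ^+ 2.
pose z := clo / chi.
have zc : z * chi = clo by rewrite /z divfK// gt_eqF.
have z0 : 0 < z by rewrite divr_gt0.
have z1 : z <= 1 by rewrite ler_pdivrMr// mul1r.
have M0 : 0 < M by rewrite mulr_gt0 ?ltr0n// exprn_gt0.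
have SA_le : SA <= #|A|%:R * lam ^+ 2.
  rewrite /SA /sqnorm (bigID (fun j => j \in A))/= [X in _ + X]big1 => [|j jA].
    rewrite addr0 mulrC -[_ *+ _]/(_) mulr_natr -sumr_const; apply: ler_sum => j jA.
    rewrite mxE jA -real_normK ?num_real// ler_sqr ?nnegrE ?(ltW lam_gt0)//.
    by rewrite sE; exact: score_A.
  by rewrite mxE (negbTE jA) expr0n.
have D_le : chi * D <= (1 - z / 2) * M.
  have -> : chi * D = SA * (chi / clo - 1) by rewrite /D; field; rewrite !gt_eqF.
  have k1 : 0 <= chi / clo - 1 by rewrite subr_ge0 ler_pdivlMr// mul1r.
  apply: le_trans (ler_wpM2r k1 SA_le) _.
  rewrite /M [leLHS]mulrAC [leRHS]mulrA; apply: ler_wpM2r; first exact: sqr_ge0.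
  by apply: dim_arith3 B1_ge => //; rewrite /z; field; rewrite !gt_eqF.
have G_sum : G = \sum_(j in B1) `|s j 0| * `|b j 0|.
  rewrite /G /dot (bigID (fun j => j \in B1))/= [X in _ + X]big1 => [|j jB].
    rewrite addr0; apply: eq_bigr => j jB.
    by rewrite [t1 j 0]mxE jB sE; have [_ _] := score_B1 jB.
  by rewrite mxE (negbTE jB) mul0r.
have projE v : sqnorm (proj B1 v) = \sum_(j in B1) `|v j 0| ^+ 2.
  rewrite /sqnorm (bigID (fun j => j \in B1))/= [X in _ + X]big1 => [|j jB].
    by rewrite addr0; apply: eq_bigr => j jB; rewrite mxE jB real_normK ?num_real.
  by rewrite mxE (negbTE jB) expr0n.
have low : (3 / 4 + z / 4) * M <=
    (3 / 4 + z / 4) * Q + (chi + clo / 2) * G + clo ^+ 2 / 4 * W.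
  rewrite /Q /W !projE G_sum !mulr_sumr -!big_split/=.
  rewrite /M mulrCA (mulr_natl _ #|B1|) -sumr_const; apply: ler_sum => j jB1.
  have [s_le lb _] := score_B1 jB1; rewrite sE.
  by apply: (dim_pointwise lam_gt0 gamma_clo lo_hi zc); rewrite ?normr_ge0.
exact: (dim_arith2 chi_gt0 clo_gt0 zc z1 M0 noise_bound_solve noise_bound_full E_le D_le low).
Qed.

End DimensionClaim.

End DimensionBound.

(** * The solution path *)

Section MCP.
Context {R : realType}.
Implicit Types (gamma lam t b s : R).

Lemma dmcpE gamma lam t : 0 < gamma -> 0 < lam -> 0 < t ->
  dmcp gamma lam t = Num.max 0 (lam - t / gamma).
Proof.
move=> g0 l0 t0.
pose f (x : R) := Num.max 0 (1 - x / (gamma * lam)).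
have cf : continuous f.
  move=> x; apply: (@continuous_max R R (cst 0) (fun x => 1 - x / (gamma * lam))).
    exact: cst_continuous.
  apply: continuousB; first exact: cst_continuous.
  by apply: continuousM => //; exact: cst_continuous.
(* The derivative is two-sided, so the interval of integration has to extend beyond [t]. *)
have [|||dF F'] := @continuous_FTC1 R f (BLeft 0) t (t + 1) _ _ _ (cf t).
- by rewrite ltrDl.
- apply: continuous_compact_integrable; first exact: segment_compact.
  by apply: continuous_subspaceT.
- by rewrite lte_fin.
rewrite /dmcp /mcp derive1Ml//; rewrite F' /f.
rewrite maxr_pMr ?(ltW l0)// mulr0; congr Num.max.
by field; rewrite !gt_eqF.
Qed.

(* One coordinate [b] of [estimating_eq], with score [s] and [dmcp] in closed form. *)
Definition est_coord gamma lam b s : Prop :=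
  (b != 0 -> s = Num.sg b * Num.max 0 (lam - `|b| / gamma)) /\
  (b = 0 -> `|s| <= lam).

Lemma estimating_eqP (n p : nat) (X : 'M[R]_(n, p)) y gamma lam (b : 'cV[R]_p) :
  0 < gamma -> 0 < lam -> estimating_eq X y gamma lam b <->
    forall j, est_coord gamma lam (b j 0) (score X y b j).
Proof.
move=> g0 l0; split=> H j; have [H1 H2] := H j; split=> // bj.
  by rewrite H1// dmcpE// normr_gt0.
by rewrite H1// dmcpE// normr_gt0.
Qed.

Lemma est_coord_pos gamma lam b s : 0 < b -> est_coord gamma lam b s ->
  s = Num.max 0 (lam - b / gamma).
Proof.
by move=> b0 [H _]; rewrite H ?gt_eqF// gtr0_sg// mul1r gtr0_norm.
Qed.

Lemma est_coord_neg gamma lam b s : b < 0 -> est_coord gamma lam b s ->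
  s = - Num.max 0 (lam + b / gamma).
Proof.
by move=> b0 [H _]; rewrite H ?lt_eqF// ltr0_sg// mulN1r ltr0_norm// mulNr opprK.
Qed.

Lemma est_coord_zero gamma lam s : est_coord gamma lam 0 s -> - lam <= s <= lam.
Proof. by move=> [_ /(_ erefl)]; rewrite ler_norml. Qed.

Lemma est_coord_le gamma lam b s : 0 < lam -> 0 < gamma ->
  est_coord gamma lam b s ->
  [/\ `|s| <= lam, (b != 0 -> lam <= `|s| + `|b| / gamma) & s * b = `|s| * `|b|].
Proof.
move=> l0 g0 es; have [b0|b0|b0] := ltgtP b 0.
- have bg : b / gamma < 0 by rewrite pmulr_llt0// invr_gt0.
  have -> := est_coord_neg b0 es; rewrite normrN (ltr0_norm b0) !mulNr mulrN.
  by rewrite /Num.max; case: ltP => h; [rewrite (gtr0_norm h)|rewrite normr0]; split=> //; lra.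
- have bg : 0 < b / gamma by rewrite divr_gt0.
  have -> := est_coord_pos b0 es; rewrite (gtr0_norm b0).
  by rewrite /Num.max; case: ltP => h; [rewrite (gtr0_norm h)|rewrite normr0]; split=> //; lra.
- by subst b; rewrite normr0 !mulr0; split=> //; apply: es.2.
Qed.

(* [s + b / gamma] is a nondecreasing function of [b]: the concavity of the
   penalty is at most [1 / gamma]. *)
Lemma est_coord_mono gamma lam b s b' s' : 0 < lam -> 0 < gamma ->
  est_coord gamma lam b s -> est_coord gamma lam b' s' ->
  (b - b') * (s' - s) <= (b - b') ^+ 2 / gamma.
Proof.
move=> l0 g0; wlog bb' : b s b' s' / b < b' => [W|] es es'.
  have [/W|/W H|->] := ltgtP b b'; first exact.
    have -> : (b - b') * (s' - s) = (b' - b) * (s - s') by ring.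
    by rewrite -sqrrN opprB; exact: H.
  by rewrite subrr mul0r expr0n mul0r.
have bg : b / gamma < b' / gamma by rewrite ltr_pM2r// invr_gt0.
have mono : s + b / gamma <= s' + b' / gamma.
  have neg (t : R) : t < 0 -> t / gamma < 0 by move=> t0; rewrite pmulr_llt0// invr_gt0.
  have pos (t : R) : 0 < t -> 0 < t / gamma by move=> t0; rewrite divr_gt0.
  have [b0|b0|b0] := ltgtP b 0; have [b'0|b'0|b'0] := ltgtP b' 0; try lra.
  - rewrite (est_coord_neg b0 es) (est_coord_neg b'0 es').
    by rewrite /Num.max; do 2 case: ifP => ?; lra.
  - rewrite (est_coord_neg b0 es) (est_coord_pos b'0 es').
    by rewrite /Num.max; have := neg _ b0; have := pos _ b'0; do 2 case: ifP => ?; lra.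
  - rewrite (est_coord_neg b0 es); subst b'; have /andP[] := est_coord_zero es'.
    by rewrite mul0r /Num.max; have := neg _ b0; case: ifP => ?; lra.
  - rewrite (est_coord_pos b0 es) (est_coord_pos b'0 es').
    by rewrite /Num.max; do 2 case: ifP => ?; lra.
  - rewrite (est_coord_pos b'0 es'); subst b; have /andP[] := est_coord_zero es.
    by rewrite mul0r /Num.max; have := pos _ b'0; case: ifP => ?; lra.
have : 0 <= (b' - b) * (s' + b' / gamma - (s + b / gamma)).
  by apply: mulr_ge0; lra.
have -> : (b' - b) * (s' + b' / gamma - (s + b / gamma)) =
  (b - b') ^+ 2 / gamma - (b - b') * (s' - s) by ring.
by rewrite subr_ge0.
Qed.

End MCP.

Section Oracle.
Context {R : realType} (n p : nat) (X : 'M[R]_(n, p)).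
Context (d : nat) (clo chi : R).
Hypotheses (n_gt0 : (0 < n)%N) (clo_gt0 : 0 < clo).
Hypothesis src : sparse_eigen_bounds X d clo chi.

Let n0 : n%:R != 0 :> R. Proof. by rewrite pnatr_eq0 -lt0n. Qed.

Lemma score_corr (y : 'cV[R]_n) (b : 'cV[R]_p) j :
  score X y b j = (X^T *m y) j 0 / n%:R - corr X b j 0.
Proof.
rewrite /score mulmxBr [in LHS]mxE [X in _ + X]mxE mulrBl; congr (_ - _).
by rewrite [RHS]mxE mulrC.
Qed.

Lemma sqnorm_eq0_of_src (B : {set 'I_p}) b : (#|B| <= d)%N ->
  supported B b -> gdot X b b <= 0 -> b = 0.
Proof.
move=> Bd sb b0; apply/eqP; rewrite -sqnorm_eq0 eq_le sqnorm_ge0 andbT.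
rewrite -(pmulr_rle0 _ clo_gt0); apply: le_trans b0.
by rewrite gdot_sqnorm; exact: (src_lower src Bd sb).
Qed.

(** [oracle_lse] is some minimizer, chosen by [xget]. Pythagoras around the solution of the normal
    equations shows that any minimizer is at zero energy from it, hence equal to it. *)
Lemma oracle_lseE (y : 'cV[R]_n) (A : {set 'I_p}) : (#|A| <= d)%N ->
  oracle_lse X y A = nsolve X A (n%:R^-1 *: (X^T *m y)).
Proof.
move=> Ad; set b0 := nsolve _ _ _.
have s0 : supported A b0 by exact: nsolve_supported.
have pyth b : supported A b -> sqnorm (y - X *m b) =
    sqnorm (y - X *m b0) + n%:R * gdot X (b0 - b) (b0 - b).
  move=> sb; have sd : supported A (b0 - b) by exact: supportedB.
  have -> : y - X *m b = (y - X *m b0) + X *m (b0 - b).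
    by rewrite mulmxBr addrA subrK.
  rewrite sqnormD gdot_sqnorm mulrCA mulfV// mulr1; congr (_ + _).
  rewrite [X in _ + 2 * X](_ : _ = 0) ?mulr0 ?addr0// dotC dot_mulmx dotC.
  rewrite (dot_supported (u := 0) sd) ?dot0l// => j jA.
  rewrite [in RHS]mxE; have := score_corr y b0 j.
  rewrite (corr_nsolve clo_gt0 src)// [X in _ - X]mxE [X in _ - X]mulrC subrr.
  by rewrite /score => /eqP; rewrite mulf_eq0 invr_eq0 (negbTE n0) orbF => /eqP.
have is0 : is_oracle_lse X y A b0.
  split=> // b sb; rewrite [leRHS]pyth// lerDl.
  by rewrite mulr_ge0 ?gdot_ge0// ltW// ltr0n.
have : is_oracle_lse X y A (oracle_lse X y A) by apply: xgetI is0.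
set o := oracle_lse _ _ _ => -[so /(_ _ s0)]; rewrite [leLHS]pyth// gerDl.
rewrite pmulr_rle0 ?ltr0n// => /(sqnorm_eq0_of_src Ad (supportedB s0 so)) /eqP.
by rewrite subr_eq0 => /eqP.
Qed.

(** [est_coord_mono], summed over the coordinates, bounds the energy of the difference by its square
    norm over [gamma]; the curvature [clo] of the loss exceeds 1 / gamma. *)
Lemma estimating_eq_unique (y : 'cV[R]_n) (B : {set 'I_p}) (gamma lam : R)
  (b b' : 'cV[R]_p) :
  0 < gamma -> 0 < lam -> 1 < gamma * clo -> (#|B| <= d)%N ->
  supported B b -> supported B b' ->
  estimating_eq X y gamma lam b -> estimating_eq X y gamma lam b' -> b = b'.
Proof.
move=> g0 l0 gc Bd sb sb' /estimating_eqP - /(_ g0 l0) eb.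
move=> /estimating_eqP - /(_ g0 l0) eb'.
have sd : supported B (b - b') by exact: supportedB.
have up : gdot X (b - b') (b - b') <= sqnorm (b - b') / gamma.
  rewrite gdot_corr /sqnorm mulr_suml; apply: ler_sum => j _.
  have := est_coord_mono l0 g0 (eb j) (eb' j); rewrite !score_corr.
  have -> : corr X (b - b') j 0 = corr X b j 0 - corr X b' j 0.
    by rewrite -scaleN1r corrD corrZ !mxE mulN1r.
  rewrite !mxE; congr (_ <= _); ring.
have lo := src_lower src Bd sd; rewrite -gdot_sqnorm in lo.
have : (clo - gamma^-1) * sqnorm (b - b') <= 0.
  by rewrite mulrBl subr_le0 (mulrC gamma^-1) (le_trans lo).
rewrite pmulr_rle0 => [b0|]; last by rewrite subr_gt0 -[ltLHS]mul1r ltr_pdivrMr// mulrC.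
apply/eqP; rewrite -subr_eq0 -sqnorm_eq0 eq_le b0; exact: sqnorm_ge0.
Qed.

End Oracle.

Section Connectedness.
Context {R : realType}.

(** Connectedness of the segment. Neighbourhoods are taken within [D] because the path is continuous
    only within the half-line, which matters at 0. *)
Lemma segment_induction (P : R -> Prop) (D : set R) (b : R) :
  `[0, b] `<=` D -> P 0 ->
  (forall x : R, 0 <= x <= b -> P x ->
     \forall t \near within D (nbhs x), 0 <= t <= b -> P t) ->
  (forall x : R, 0 <= x <= b -> ~ P x ->
     \forall t \near within D (nbhs x), ~ P t) ->
  forall x : R, 0 <= x <= b -> P x.
Proof.
move=> bD P0 Popen Pclosed x /[dup] xb /andP[x0 x_b].
pose S : set R := [set` `[0, b]].
have cS : connected S by apply/connected_intervalP; exact: interval_is_interval.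
have S0 : S 0 by rewrite /S/= in_itv/= lexx (le_trans x0).
suff SP : S `&` P = S.
  have Sx : S x by rewrite /S/= in_itv/= xb.
  by move: Sx; rewrite -[S]SP => -[].
apply: cS; first by exists 0.
- exists ([set t | S t -> P t]°); first exact: open_interior.
  apply/seteqP; split => t [St]; last by move/interior_subset => /(_ St).
  move=> Pt; split=> //; have tb : 0 <= t <= b by move: St; rewrite /S/= in_itv.
  have nt : nbhs t [set u | D u -> 0 <= u <= b -> P u] := Popen _ tb Pt.
  apply: (filterS _ nt) => u H Su.
  by apply: H; [exact: bD|move: Su; rewrite /S/= in_itv].
- exists (closure (S `&` P)); first exact: closed_closure.
  apply/seteqP; split => t [St Pt]; first by split=> //; exact: subset_closure.
  split=> //; apply: contrapT => nPt.
  have tb : 0 <= t <= b by move: St; rewrite /S/= in_itv.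
  have nt : nbhs t [set u | D u -> ~ P u] := Pclosed _ tb nPt.
  have [u [[Su Pu] H]] := Pt _ nt.
  by apply: H Pu; exact: bD.
Qed.

End Connectedness.

Lemma set_between (T : finType) (M N : {set T}) (m : nat) :
  M \subset N -> (#|M| <= m <= #|N|)%N ->
  exists B : {set T}, [/\ M \subset B, B \subset N & #|B| = m].
Proof.
move=> MN /andP[Mm mN].
elim: m Mm mN => [|m IH].
  by rewrite leqn0 => /eqP M0 _; exists M; split.
rewrite leq_eqVlt => /orP[/eqP <- _|]; first by exists M.
rewrite ltnS => Mm mN; have [B [MB BN Bm]] := IH Mm (ltnW mN).
have /fintype.properP[_ [x xN xB]] : B \proper N.
  by rewrite properEcard BN Bm.
exists (x |: B); split; last by rewrite cardsU1 xB Bm.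
- exact: fintype.subset_trans MB (finset.subsetUr _ _).
- by rewrite finset.subUset finset.sub1set xN.
Qed.

Section Path.
Context {R : realType} (n p : nat) (X : 'M[R]_(n, p)) (y : 'cV[R]_n).
Context (d : nat) (clo chi gamma : R) (A : {set 'I_p}).
Context (lam : R -> R) (bhat : R -> 'cV[R]_p) (l1 l2 E : R).
Let m := (d - #|A|)%N.
Let o := oracle_lse X y A.
Hypothesis n_gt0 : (0 < n)%N.
Hypothesis clo_gt0 : 0 < clo.
Hypothesis lo_hi : clo <= chi.
Hypothesis src : sparse_eigen_bounds X d clo chi.
Hypothesis gamma_clo : 2 <= gamma * clo.
Hypothesis A_lt_d : (#|A| < d)%N.
Hypothesis m_ge : (chi / clo - 2^-1) * #|A|%:R <= m%:R.
Hypothesis l1_gt0 : 0 < l1.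
Hypothesis l1_l2 : l1 <= l2.
Hypothesis o_large : forall j, j \in A -> gamma * l2 <= `|o j 0|.
Hypothesis o_score : forall j, j \notin A -> `|score X y o j| < l1.
Hypothesis E_ge0 : 0 <= E.
Hypothesis E_le : E * chi <= 9 / 32 * (m%:R * l2 ^+ 2).
Hypothesis noise : forall B1 : {set 'I_p},
  (forall j, j \in A -> j \notin B1) -> #|B1| = m ->
  forall z, supported (A :|: B1) z -> {in A, forall j, corr X z j 0 = 0} ->
  (dot (X *m z) y / n%:R) ^+ 2 <= E * gdot X z z.
Hypothesis path : solution_path X y gamma lam bhat.

Let gamma_gt0 : 0 < gamma.
Proof. by rewrite -(pmulr_lgt0 _ clo_gt0) (lt_le_trans _ gamma_clo). Qed.

Let Ad : (#|A| <= d)%N. Proof. exact: ltnW. Qed.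
Let m_gt0 : (0 < m)%N. Proof. by rewrite subn_gt0. Qed.

Let o_supp : supported A o.
Proof. by rewrite /o (oracle_lseE n_gt0 clo_gt0 src)//; exact: nsolve_supported. Qed.

Let o_score0 j : j \in A -> score X y o j = 0.
Proof.
move=> jA; rewrite score_corr /o (oracle_lseE n_gt0 clo_gt0 src)//.
by rewrite (corr_nsolve clo_gt0 src)// [X in _ - X]mxE mulrC subrr.
Qed.

Lemma oracle_solution l : l1 <= l <= l2 -> estimating_eq X y gamma l o.
Proof.
move=> /andP[l1l ll2]; have l0 : 0 < l by exact: lt_le_trans l1l.
apply/estimating_eqP => // j; have [jA|jA] := boolP (j \in A); last first.
  rewrite o_supp//; split=> [|_]; first by rewrite eqxx.
  by apply: ltW; apply: lt_le_trans l1l; exact: o_score.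
have oj := o_large jA.
have gl : gamma * l <= `|o j 0| by rewrite (le_trans _ oj)// ler_pM2l.
have o0 : 0 < `|o j 0| by rewrite (lt_le_trans _ gl)// mulr_gt0.
split=> [_|oj0]; last by move: o0; rewrite oj0 normr0 ltxx.
rewrite o_score0//; rewrite max_l ?mulr0// subr_le0 ler_pdivlMr//.
by rewrite mulrC.
Qed.

(** [M] is what must stay small, [N] what [dimension_bound] controls. For t near x, M at t contains
    M at x and is contained in N at x: the first inclusion makes the condition on [M] closed, the
    second makes it open once N has fewer than [m] elements. *)
Let M (b : 'cV[R]_p) := [set j | (j \notin A) && (b j 0 != 0)]%SET.
Let N (l : R) (b : 'cV[R]_p) :=
  [set j | (j \notin A) && ((b j 0 != 0) || (l <= `|score X y b j|))]%SET.

Lemma supportedM b : supported (A :|: M b) b.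
Proof.
move=> j; rewrite !inE negb_or negb_and !negbK => /andP[jA].
by rewrite (negbTE jA) => /eqP.
Qed.

Lemma small_solution_oracle l b : l1 <= l <= l2 -> (#|M b| <= m)%N ->
  estimating_eq X y gamma l b -> b = o.
Proof.
move=> /[dup] ll /andP[l1l ll2] Mm eb.
have l0 : 0 < l by exact: lt_le_trans l1l.
apply: (estimating_eq_unique src (B := A :|: M b) gamma_gt0 l0 _ _ _ _ eb).
- by rewrite (lt_le_trans _ gamma_clo)// ltr1n.
- by rewrite (leq_trans (leq_card_setU _ _))// -[leqRHS](subnKC Ad) leq_add2l.
- exact: supportedM.
- exact: supportedS (finset.subsetUl _ _) o_supp.
- exact: oracle_solution.
Qed.

(* Otherwise [dimension_bound] applies to a set of [m] indices between [M b] and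
   [N l b]. *)
Lemma active_lt l b : l1 <= l -> (#|M b| <= m)%N ->
  estimating_eq X y gamma l b -> (#|N l b| < m)%N.
Proof.
move=> l1l Mm eb; have l0 : 0 < l by exact: lt_le_trans l1l.
(* Up to [l2] the solution is [o] itself, and [N] is empty since the scores of [o] off [A] are
   strictly below [l1]. *)
have [ll2|l2l] := leP l l2.
  have -> : b = o by apply: small_solution_oracle eb => //; rewrite l1l.
  suff -> : N l o = finset.set0 by rewrite cards0.
  apply/setP => j; rewrite !inE; have [//|jA/=] := boolP (j \in A).
  by rewrite o_supp// eqxx/= leNgt (lt_le_trans (o_score jA)).
rewrite ltnNge; apply/negP => mN.
have MN : M b \subset N l b.
  by apply/fintype.subsetP => j; rewrite !inE => /andP[-> ->].
have [|B [MB BN Bm]] := set_between MN (m := m); first by rewrite Mm.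
have AB j : j \in A -> j \notin B.
  by apply: contraTN => /(fintype.subsetP BN); rewrite inE => /andP[].
have /estimating_eqP est := eb.
have ec j := est_coord_le l0 gamma_gt0 (est gamma_gt0 l0 j).
apply: (@dimension_bound _ _ _ X d clo chi clo_gt0 _ src A B l gamma E b y) => //.
- exact: lt_le_trans lo_hi.
- by rewrite (leq_trans (leq_card_setU _ _))// Bm -[leqRHS](subnKC Ad).
- by rewrite Bm.
- by rewrite Bm.
- by apply: supportedS (@supportedM b); exact: finset.setUS.
- by move=> j _; have [] := ec j.
- move=> j jB; have [e1 e2 e3] := ec j; split=> //.
  have := fintype.subsetP BN j jB; rewrite !inE => /andP[_ /orP[/e2//|le_s]].
  by rewrite (le_trans le_s)// lerDl divr_ge0// ltW.
- exact: noise.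
- apply: (le_trans E_le); rewrite Bm ler_wpM2l ?divr_ge0// ler_wpM2l//.
  by rewrite ler_sqr ?nnegrE ?(ltW l0) ?ltW// (lt_le_trans l1_gt0).
Qed.

Let D : set R := [set` `[0, +oo[].
Let Dle (x : R) : 0 <= x -> D x. Proof. by move=> x0; rewrite /D/= in_itv/= x0. Qed.

Let lam_cvg (x : R) : 0 <= x -> lam t @[t --> within D (nbhs x)] --> lam x.
Proof. by move=> x0; have [/subspace_continuousP H _ _ _ _] := path; exact: H (Dle x0). Qed.

Let bhat_cvg (x : R) j : 0 <= x ->
  bhat t j 0 @[t --> within D (nbhs x)] --> bhat x j 0.
Proof.
move=> x0; have [_ /subspace_continuousP H _ _ _] := path.
apply: (@cvg_comp _ _ _ bhat (fun b : 'cV[R]_p => b j 0) _ (nbhs (bhat x))).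
  exact: H (Dle x0).
exact: coord_continuous.
Qed.

Let score_cvg (x : R) j : 0 <= x ->
  score X y (bhat t) j @[t --> within D (nbhs x)] --> score X y (bhat x) j.
Proof.
move=> x0.
have scE b : score X y b j =
    (\sum_i X i j * (y i 0 - \sum_k X i k * b k 0)) * n%:R^-1.
  rewrite /score mxE; congr (_ * _); apply: eq_bigr => i _; rewrite !mxE.
  by congr (_ * (_ - _)).
under eq_fun do rewrite scE; rewrite scE.
apply: cvgM; last exact: cvg_cst.
apply: cvg_big => [|i _]; first exact: add_continuous.
apply: cvgM; first exact: cvg_cst.
apply: cvgB; first exact: cvg_cst.
apply: cvg_big => [|k _]; first exact: add_continuous.
apply: cvgM; first exact: cvg_cst.
exact: bhat_cvg.
Qed.

Let est (x : R) : 0 <= x -> estimating_eq X y gamma (lam x) (bhat x).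
Proof. by have [_ _ H _ _] := path; exact: H. Qed.

(** If the entry is 0 and the score strictly below the level at x, then
    [lam - |score| - |entry| / gamma] stays positive nearby, while any nonzero entry of a solution
    makes it nonpositive. *)
Let near_N (x : R) : 0 <= x -> 0 < lam x ->
  \forall t \near within D (nbhs x), M (bhat t) \subset N (lam x) (bhat x).
Proof.
move=> x0 lx; have F : Filter (within D (nbhs x)) by exact: within_filter.
have H j : \forall t \near within D (nbhs x),
    j \in M (bhat t) -> j \in N (lam x) (bhat x).
  have [jN|jN] := boolP (j \in N (lam x) (bhat x)); first exact: nearW.
  have [jA|jA] := boolP (j \in A).
    by apply: nearW => t; rewrite inE jA.
  move: jN; rewrite inE jA/= negb_or negbK -ltNge => /andP[/eqP bj sj].
  have l_near : \forall t \near within D (nbhs x), 0 < lam t.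
    by apply: (cvgr_gt (lam x)) => //; exact: lam_cvg.
  have g_near : \forall t \near within D (nbhs x),
      0 < lam t - `|score X y (bhat t) j| - `|bhat t j 0| / gamma.
    apply: (cvgr_gt (lam x - `|score X y (bhat x) j| - `|bhat x j 0| / gamma)).
      apply: cvgB; last first.
        by apply: cvgM; [apply: cvg_norm; exact: bhat_cvg|exact: cvg_cst].
      by apply: cvgB; [exact: lam_cvg|apply: cvg_norm; exact: score_cvg].
    by rewrite bj normr0 mul0r subr0 subr_gt0.
  have D_near : \forall t \near within D (nbhs x), D t by exact: withinT.
  near=> t; rewrite inE jA/= => bt.
  have Dt : D t by near: t.
  have t0 : 0 <= t by move: Dt; rewrite /D/= in_itv/= andbT.
  have lt0 : 0 < lam t by near: t.
  have gt0 : 0 < lam t - `|score X y (bhat t) j| - `|bhat t j 0| / gamma by near: t.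
  have /estimating_eqP - /(_ gamma_gt0 lt0) /(_ j) := est t0.
  by move=> /(est_coord_le lt0 gamma_gt0)[_ /(_ bt) + _]; lra.
have := filter_forall F H; apply: filterS => t Ht.
by apply/fintype.subsetP => j; exact: Ht.
Unshelve. all: by end_near. Qed.

Let near_M (x : R) : 0 <= x ->
  \forall t \near within D (nbhs x), M (bhat x) \subset M (bhat t).
Proof.
move=> x0; have F : Filter (within D (nbhs x)) by exact: within_filter.
have H j : \forall t \near within D (nbhs x),
    j \in M (bhat x) -> j \in M (bhat t).
  have [|jM] := boolP (j \in M (bhat x)); last exact: nearW.
  rewrite inE => /andP[jA bj].
  have : \forall t \near within D (nbhs x), 0 < `|bhat t j 0|.
    apply: (cvgr_gt `|bhat x j 0|); last by rewrite normr_gt0.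
    by apply: cvg_norm; exact: bhat_cvg.
  by apply: filterS => t; rewrite normr_gt0 inE jA => ->.
have := filter_forall F H; apply: filterS => t Ht.
by apply/fintype.subsetP => j; exact: Ht.
Qed.

Lemma selector_oracle : selector lam bhat l1 = o.
Proof.
have [_ _ _ b0 lam0] := path.
rewrite /selector; set S := [set x | _]; set xs := inf S.
have S0 : S !=set0.
  have : \forall x \near +oo, lam x < l1 by exact: (cvgr_lt 0).
  move=> /(filterI (nbhs_pinfty_ge (num_real 0))) /filter_ex[x [x0 lx]].
  by exists x; split=> //; exact: ltW.
have lbS : has_lbound S by exists 0 => x [].
have xs0 : 0 <= xs by apply: lb_le_inf => // x [].
have Sxs : lam xs <= l1.
  rewrite leNgt; apply/negP => lxs.
  have near_xs : \forall t \near within D (nbhs xs), l1 < lam t.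
    by apply: (cvgr_gt (lam xs)) => //; exact: lam_cvg.
  have : nbhs xs [set t | D t -> l1 < lam t] := near_xs.
  move=> /nbhs_ballP[e /= e0 H].
  have [x [x0 lx] xe] := inf_adherent e0 (conj S0 lbS).
  have xsx : xs <= x by apply: ge_inf.
  have : l1 < lam x.
    by apply: H; [rewrite /ball/= ltr_distlC; lra|exact: Dle].
  by rewrite ltNge lx.
have below (x : R) : 0 <= x -> x < xs -> l1 < lam x.
  move=> x0 xxs; rewrite ltNge; apply/negP => lx.
  by move: xxs; rewrite ltNge => /negP; apply; exact: ge_inf.
have l0 : (#|M 0| <= m)%N.
  rewrite (_ : M 0 = finset.set0) ?cards0//.
  by apply/setP => j; rewrite !inE mxE eqxx andbF.
(* If the path starts at or below [l1], its level at [xs] may be too low for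
   [small_solution_oracle]. But the zero vector, a solution at level [lam 0], is then also one at
   level [l1]. *)
have [xs_eq0|xs_neq0] := eqVneq xs 0.
  rewrite xs_eq0 b0; apply: (@small_solution_oracle l1) => //; first by rewrite lexx.
  have := est xs0; rewrite xs_eq0 b0 => e0 j; have [e1 e2] := e0 j.
  split=> bj; first by move: bj; rewrite mxE eqxx.
  by rewrite (le_trans (e2 bj))// -xs_eq0.
have xs_gt0 : 0 < xs by rewrite lt_neqAle eq_sym xs_neq0.
have above (x : R) : 0 <= x <= xs -> l1 <= lam x.
  move=> /andP[x0]; rewrite le_eqVlt => /orP[/eqP ->|]; last first.
    by move=> /(below _ x0) /ltW.
  rewrite leNgt; apply/negP => lxs.
  have near_xs : \forall t \near within D (nbhs xs), lam t < l1.
    by apply: (cvgr_lt (lam xs)) => //; exact: lam_cvg.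
  have : nbhs xs [set t | D t -> lam t < l1] := near_xs.
  move=> /nbhs_ballP[e /= e0 H].
  (* A nonnegative point before [xs] and within [e] of it, where [below] applies. *)
  pose t := xs - Num.min xs e / 2.
  have me : 0 < Num.min xs e by rewrite lt_min xs_gt0.
  have mxs : Num.min xs e <= xs by rewrite ge_min lexx.
  have mxe : Num.min xs e <= e by rewrite ge_min lexx orbT.
  have t0 : 0 <= t by rewrite /t; lra.
  have : lam t < l1.
    by apply: H; [rewrite /ball/= ltr_distlC /t; lra|exact: Dle].
  by rewrite ltNge ltW// below// /t; lra.
have key (x : R) : 0 <= x <= xs -> (#|M (bhat x)| <= m)%N.
  apply: (@segment_induction _ (fun x => #|M (bhat x)| <= m)%N D) => //.
  - by move=> t; rewrite /= in_itv/= => /andP[t0 _]; exact: Dle.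
  - by rewrite b0.
  - move=> t /[dup] txs /andP[t0 _] Mt.
    have lt1 := above t txs.
    have Nt := active_lt lt1 Mt (est t0).
    have := near_N t0 (lt_le_trans l1_gt0 lt1); apply: filterS => u MN _.
    by rewrite (leq_trans (subset_leq_card MN))// ltnW.
  - move=> t /andP[t0 _] Mt; have := near_M t0; apply: filterS => u MM Mu.
    by apply: Mt; exact: leq_trans (subset_leq_card MM) Mu.
apply: (@small_solution_oracle (lam xs)); last exact: est.
- by rewrite above ?xs0 ?lexx// (le_trans Sxs).
- by apply: key; rewrite xs0 lexx.
Qed.

End Path.

(** * Gaussian tails *)

(** Packs [pushforward] with its measure structure, for use inside integrals and [mscale]. *)
Definition image_measure d d' (T1 : measurableType d) (T2 : measurableType d')
  (R : realFieldType) (m : {measure set T1 -> \bar R}) (f : T1 -> T2)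
  (mf : measurable_fun setT f) : {measure set T2 -> \bar R}.
Proof. by unshelve refine (pushforward m f : {measure set T2 -> \bar R}). Defined.

Section NormalProb.
Context {R : realType}.
Local Notation mu := (@lebesgue_measure R).
Implicit Types (m s u x y : R) (C : set R).

(** The Radon-Nikodym derivative of [normal_prob] agrees almost everywhere with the density, because
    both integrate to the same value on every measurable set. *)
Lemma ge0_integral_normal_prob m s (f : R -> \bar R) :
  measurable_fun [set: R] f -> (forall x, (0 <= f x)%E) ->
  (\int[normal_prob m s]_x f x = \int[mu]_x (f x * (normal_pdf m s x)%:E))%E.
Proof.
move=> mf f0; pose P : {finite_measure set _ -> \bar R} := normal_prob m s.
have dom : P `<< mu by exact: normal_prob_dominates.
have mpdf : measurable_fun setT (EFin \o normal_pdf m s).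
  by apply/measurable_EFinP; exact: measurable_normal_pdf.
rewrite -(@Radon_Nikodym_SigmaFinite.change_of_variables _ _ _ P mu dom f setT)//.
have mrn : measurable_fun setT (Radon_Nikodym_SigmaFinite.f P mu).
  by apply: (measurable_int mu); exact: Radon_Nikodym_SigmaFinite.f_integrable.
apply: ae_eq_integral => //; [exact: emeasurable_funM..|].
apply: ae_eqe_mul2l; apply: integral_ae_eq => //.
  exact: Radon_Nikodym_SigmaFinite.f_integrable.
by move=> E _ mE; rewrite -Radon_Nikodym_SigmaFinite.f_integral.
Qed.

Lemma lebesgue_affine u x (f : R -> \bar R) : u != 0 ->
  measurable_fun [set: R] f -> (forall x, (0 <= f x)%E) ->
  (\int[mu]_y f y = `|u|%:E * \int[mu]_y f (x + u * y)%R)%E.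
Proof.
move=> u0 mf f0.
have u1 : 0 < `|u| by rewrite normr_gt0.
have mphi : measurable_fun [set: R] (fun y => x + u * y : R).
  apply: measurable_funD => //; exact: measurable_funM.
pose k : {nonneg R} := NngNum (ltW u1).
pose phi : measurableTypeR R -> measurableTypeR R := fun y => x + u * y.
have mphi' : measurable_fun [set: measurableTypeR R] phi by [].
pose mu' := mscale k (image_measure mu mphi').
(* By uniqueness it is enough to compare on half-open intervals; a negative [u] exchanges the open
   and the closed end. *)
have E A : measurable A -> mu A = mu' A.
  apply: (@lebesgue_measure_unique R (mscale k (image_measure mu mphi'))).
  move=> _ [[a b] _ <-]; rewrite /= /mscale/= /pushforward/=.
  have [un|up|u00] := ltgtP u 0; last by rewrite u00 eqxx in u0.
    have -> : phi @^-1` `]a, b] = [set` `[(b - x) / u, (a - x) / u[].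
      apply/seteqP; split => y; rewrite /= !in_itv/= /phi;
      by rewrite ler_ndivrMr// ltr_ndivlMr// lerBrDl ltrBlDl mulrC andbC.
    rewrite !lebesgue_measure_itv/= !lte_fin ltr_nM2r ?invr_lt0// ltrD2r.
    case: ifP => _; last by rewrite mule0.
    rewrite -!EFinB -EFinM (ltr0_norm un); congr EFin.
    by field; rewrite lt_eqF.
  have -> : phi @^-1` `]a, b] = [set` `](a - x) / u, (b - x) / u]].
    apply/seteqP; split => y; rewrite /= !in_itv/= /phi;
    by rewrite ler_pdivlMr// ltr_pdivrMr// lerBrDl ltrBlDl mulrC.
  rewrite !lebesgue_measure_itv/= !lte_fin ltr_pM2r ?invr_gt0// ltrD2r.
  case: ifP => _; last by rewrite mule0.
  rewrite -!EFinB -EFinM (gtr0_norm up); congr EFin.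
  by field; rewrite gt_eqF.
transitivity (\int[mu']_y f y)%E.
  by apply: eq_measure_integral => A mA _; exact: E.
rewrite ge0_integral_mscale//; congr (_ * _)%E.
by rewrite ge0_integral_pushforward.
Qed.

End NormalProb.

Section NormalSum.
Context {R : realType}.
Local Notation mu := (@lebesgue_measure R).
Implicit Types (m s u x y w r : R) (C : set R).

Lemma normal_pdf_def m s x : s != 0 ->
  normal_pdf m s x = (Num.sqrt (s ^+ 2 * pi *+ 2))^-1 *
    expR (- (x - m) ^+ 2 / (s ^+ 2 *+ 2)).
Proof. by move=> s0; rewrite normal_pdfE. Qed.

Lemma normal_prob_abs m s C : s != 0 -> normal_prob m `|s| C = normal_prob m s C.
Proof.
move=> s0; rewrite /normal_prob; apply: eq_integral => x _; congr EFin.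
by rewrite !normal_pdf_def ?normr_eq0// real_normK ?num_real.
Qed.

Lemma normal_pdf_affine m s u x y : s != 0 -> u != 0 ->
  `|u| * normal_pdf (x + u * m) (u * s) (x + u * y) = normal_pdf m s y.
Proof.
move=> s0 u0; rewrite !normal_pdf_def ?mulf_neq0// mulrA; congr (_ * expR _).
  rewrite exprMn -mulrA -mulrnAr sqrtrM ?sqr_ge0// sqrtr_sqr invfM mulrA.
  by rewrite mulfV ?normr_eq0// mul1r.
by field; rewrite s0.
Qed.

Lemma normal_prob_affine m s u x C : s != 0 -> u != 0 -> measurable C ->
  normal_prob m s ((fun y => x + u * y) @^-1` C) =
  normal_prob (x + u * m) (u * s) C.
Proof.
move=> s0 u0 mC.
rewrite /normal_prob [LHS]integral_mkcond [RHS]integral_mkcond.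
have mpdf : measurable_fun [set: R] (EFin \o normal_pdf (x + u * m) (u * s)).
  by apply/measurable_EFinP; exact: measurable_normal_pdf.
have mr : measurable_fun [set: R] ((EFin \o normal_pdf (x + u * m) (u * s)) \_ C).
  by apply/(measurable_restrictT _ mC); exact: measurable_funTS.
have r0 y : (0 <= ((EFin \o normal_pdf (x + u * m) (u * s)) \_ C) y)%E.
  by rewrite patchE; case: ifP => // _; rewrite lee_fin normal_pdf_ge0.
rewrite [RHS](lebesgue_affine x u0)// -ge0_integralZl//=.
- apply: eq_integral => y _; rewrite !patchE.
  have -> : (y \in (fun y => x + u * y) @^-1` C) = (x + u * y \in C) by [].
  by case: ifP => _; [rewrite -EFinM normal_pdf_affine|rewrite mule0].
- by apply: measurableT_comp mr _; exact: measurable_funD.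
Qed.

(** Bayes' formula: prior of x times likelihood of w is the marginal density of w times the
    posterior density of x. *)
Lemma normal_pdf_mul s r x w : s != 0 -> r != 0 ->
  let S := Num.sqrt (s ^+ 2 + r ^+ 2) in
  normal_pdf 0 s x * normal_pdf x r w =
  normal_pdf 0 S w * normal_pdf (w * s ^+ 2 / S ^+ 2) (s * r / S) x.
Proof.
move=> s0 r0 S.
have s2 : 0 < s ^+ 2 by rewrite exprn_even_gt0.
have r2 : 0 < r ^+ 2 by rewrite exprn_even_gt0.
have S2 : S ^+ 2 = s ^+ 2 + r ^+ 2 by rewrite sqr_sqrtr// ltW// addr_gt0.
have S0 : S != 0 by rewrite -sqrf_eq0 S2 gt_eqF// addr_gt0.
have t0 : s * r / S != 0 by rewrite !mulf_neq0 ?invr_neq0.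
have pos a : 0 <= a ^+ 2 * pi *+ 2 :> R.
  by rewrite mulrn_wge0// mulr_ge0 ?sqr_ge0 ?pi_ge0.
rewrite !normal_pdf_def// mulrACA [RHS]mulrACA -!expRD; congr (_ * expR _).
  rewrite -!invfM -!sqrtrM//; congr (_^-1); congr (Num.sqrt _).
  by field.
rewrite !expr_div_n !exprMn S2; field.
by rewrite s0 r0 gt_eqF ?addr_gt0.
Qed.

(** After Tonelli and [normal_pdf_mul], the inner integral is that of a posterior density, which is
    1. *)
Lemma normal_prob_add s r u C : s != 0 -> r != 0 -> u != 0 -> measurable C ->
  (normal_prob 0 s \x normal_prob 0 r)%E [set z | C (z.1 + u * z.2)] =
  normal_prob 0 (Num.sqrt (s ^+ 2 + (u * r) ^+ 2)) C.
Proof.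
move=> s0 r0 u0 mC; set S := Num.sqrt _.
have ur0 : u * r != 0 by rewrite mulf_neq0.
have S0 : S != 0.
  rewrite sqrtr_eq0 -ltNge ltr_wpDr ?sqr_ge0//.
  by rewrite exprn_even_gt0.
have mpdf m t : measurable_fun [set: R] (EFin \o normal_pdf m t).
  by apply/measurable_EFinP; exact: measurable_normal_pdf.
pose A : set (R * R) := [set z | C (z.1 + u * z.2)].
have mA : measurable A.
  rewrite -[A]setTI; apply: (_ : measurable_fun [set: R * R] _) mC => //.
  by apply: measurable_funD => //; exact: measurable_funM.
have EA x : normal_prob 0 r (xsection A x) = normal_prob x (u * r) C.
  have := normal_prob_affine 0 x r0 u0 mC; rewrite mulr0 addr0 => <-.
  by congr (normal_prob _ _ _); apply/seteqP; split => y; rewrite /xsection/= inE.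
have mE : measurable_fun [set: R] (fun x => normal_prob x (u * r) C).
  rewrite (_ : (fun x => _) = normal_prob 0 r \o xsection A).
    exact: measurable_fun_xsection.
  by apply/funext => x/=; rewrite EA.
rewrite /product_measure1.
transitivity (\int[normal_prob 0 s]_x normal_prob x (u * r) C)%E.
  by apply: eq_integral => x _; exact: EA.
pose f (z : R * R) : \bar R := ((normal_pdf 0 s z.1 * normal_pdf z.1 (u * r) z.2) *
  \1_C z.2)%:E.
have mf : measurable_fun [set: R * R] f.
  apply/measurable_EFinP; apply: measurable_funM; last first.
    by apply: measurableT_comp => //; exact: measurable_indic.
  apply: measurable_funM.
    by apply: measurableT_comp => //; exact: measurable_normal_pdf.
  rewrite (_ : (fun z : R * R => _) = normal_pdf 0 (u * r) \o (fun z => z.2 - z.1)).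
    apply: measurableT_comp; first exact: measurable_normal_pdf.
    exact: measurable_funB.
  by apply/funext => z /=; rewrite !normal_pdf_def// subr0.
have f0 z : (0 <= f z)%E by rewrite lee_fin !mulr_ge0 ?normal_pdf_ge0.
transitivity (\int[mu]_x \int[mu]_w f (x, w))%E.
  rewrite ge0_integral_normal_prob//.
  apply: eq_integral => x _; rewrite /normal_prob integral_mkcond muleC.
  rewrite -ge0_integralZl//=.
  - apply: eq_integral => w _; rewrite patchE /f/= indicE.
    by case: ifP => _; rewrite ?mulr1 ?mulr0 ?mule0// EFinM.
  - by apply/(measurable_restrictT _ mC)/measurable_funTS; exact: mpdf.
  - by move=> w _; rewrite patchE; case: ifP => // _; rewrite lee_fin normal_pdf_ge0.
  - by rewrite lee_fin normal_pdf_ge0.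
transitivity (\int[mu]_w \int[mu]_x f (x, w))%E.
  exact: (@fubini_tonelli _ _ _ _ R mu mu f mf f0).
rewrite /normal_prob [RHS]integral_mkcond; apply: eq_integral => w _.
rewrite patchE /f/= indicE; case: ifP => _; last first.
  by under eq_integral do rewrite mulr0; rewrite integral0.
under eq_integral do rewrite mulr1 normal_pdf_mul// EFinM.
rewrite ge0_integralZl//=; last by rewrite lee_fin normal_pdf_ge0.
- by rewrite integral_normal_pdf mule1.
- exact: mpdf.
- by move=> x _; rewrite lee_fin normal_pdf_ge0.
Qed.

End NormalSum.

(** * Linear combinations of the noise *)

Section GaussianCombination.
Context {R : realType} (d : measure_display) (T : measurableType d).
Context (P : probability T R) (n : nat) (sigma : R).
Context (eps : 'I_n -> {RV P >-> R}).
Hypothesis sigma_gt0 : 0 < sigma.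
Hypothesis noise : gaussian_noise sigma eps.

(** Independence is given as a product rule over all coordinates, so the law of a linear combination
    is built by absorbing one coordinate at a time into [J], with the constraints on the remaining
    ones carried along as [event] and their probability as [weight]. *)
Let event (J : {set 'I_n}) (B : 'I_n -> set R) : set T :=
  \bigcap_(i in [set i | i \notin J]) (eps i @^-1` B i).

Let weight (J : {set 'I_n}) (B : 'I_n -> set R) : R :=
  \prod_(i | i \notin J) fine (P (eps i @^-1` B i)).

(* [Z] is N(0, s^2) and is independent of the coordinates outside [J]. *)
Let normal_off (Z : T -> R) (s : R) (J : {set 'I_n}) : Prop :=
  forall C B, measurable C -> (forall i, measurable (B i)) ->
  P (Z @^-1` C `&` event J B) = (normal_prob 0 s C * (weight J B)%:E)%E.

Let measurable_eps i : measurable_fun [set: T] (eps i : T -> R).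
Proof. by []. Qed.

Let measurable_pre i (B : set R) : measurable B -> measurable (eps i @^-1` B).
Proof. by move=> mB; rewrite -[X in measurable X]setTI; exact: measurable_funP. Qed.

Let measurable_event J B : (forall i, measurable (B i)) -> measurable (event J B).
Proof.
move=> mB; apply: fin_bigcap_measurable; first exact: finite_finset.
by move=> i _; exact: measurable_pre.
Qed.

Let eventS (J : {set 'I_n}) i B : i \notin J ->
  event J B = (eps i @^-1` B i) `&` event (i |: J) B.
Proof.
move=> iJ; apply/seteqP; split => w /=.
  move=> H; split; first exact: H.
  by move=> j /=; rewrite !inE negb_or => /andP[_ jJ]; exact: H.
move=> [Hi H] j /= jJ; have [->//|ji] := eqVneq j i.
by apply: H; rewrite /= !inE negb_or ji.
Qed.

Let weightS (J : {set 'I_n}) i B : i \notin J ->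
  weight J B = fine (P (eps i @^-1` B i)) * weight (i |: J) B.
Proof.
move=> iJ; rewrite /weight (bigD1 i)//=; congr (_ * _); apply: eq_bigl => j.
by rewrite !inE negb_or andbC.
Qed.

Let eq_event (J : {set 'I_n}) (B B' : 'I_n -> set R) : {in [predC J], forall i, B i = B' i} ->
  event J B = event J B'.
Proof.
by move=> BB; apply/seteqP; split => w H j /= jJ; have := H j jJ; rewrite BB.
Qed.

Let eq_weight (J : {set 'I_n}) (B B' : 'I_n -> set R) : {in [predC J], forall i, B i = B' i} ->
  weight J B = weight J B'.
Proof. by move=> BB; apply: eq_bigr => j jJ; rewrite BB. Qed.

Let weight_ge0 J B : 0 <= weight J B.
Proof. by apply: prodr_ge0 => i _; exact: fine_ge0. Qed.

Let upd (B : 'I_n -> set R) i (D : set R) j := if j == i then D else B j.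

Let updP (J : {set 'I_n}) B i D : {in [predC (i |: J)], forall j, upd B i D j = B j}.
Proof.
by move=> j; rewrite !inE negb_or => /andP[/negbTE ji _]; rewrite /upd ji.
Qed.

Let normal_off_weaken Z s J i : normal_off Z s J -> normal_off Z s (i |: J).
Proof.
have [iJ|iJ] := boolP (i \in J); first by rewrite (finset.setUidPr _) // finset.sub1set.
move=> H C B mC mB.
have mU j : measurable (upd B i setT j) by rewrite /upd; case: ifP.
have := H C _ mC mU; rewrite (eventS _ iJ) (weightS _ iJ).
rewrite (eq_event (@updP J B i setT)) (eq_weight (@updP J B i setT)).
by rewrite /upd eqxx preimage_setT setTI probability_setT mul1r.
Qed.

(** Under [P] restricted to the event on the remaining coordinates, the pair (Z, eps i) has a
    product law up to the factor [weight]; this is checked on rectangles, and [normal_prob_add] then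
    gives the law of the sum. *)
Let normal_off_step (Z : T -> R) (s : R) (J : {set 'I_n}) i (u : R) : i \notin J -> u != 0 -> s != 0 ->
  measurable_fun setT Z -> normal_off Z s J ->
  normal_off (fun w => Z w + u * eps i w) (Num.sqrt (s ^+ 2 + (u * sigma) ^+ 2))
    (i |: J).
Proof.
move=> iJ u0 s0 mZ H C B mC mB.
have sig0 : sigma != 0 by rewrite gt_eqF.
set E := event (i |: J) B; have mE : measurable E by exact: measurable_event.
pose V (w : T) : measurableTypeR R * measurableTypeR R := (Z w, eps i w).
have mV : measurable_fun setT V.
  exact: (@measurable_fun_pair _ _ _ _ (measurableTypeR R) (measurableTypeR R)
    _ _ mZ (measurable_eps i)).
pose k : {nonneg R} := NngNum (weight_ge0 (i |: J) B).
pose m1 := mscale k (normal_prob 0 s).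
pose nu := image_measure (mrestr P mE) mV.
have prodE A : measurable A -> (m1 \x normal_prob 0 sigma)%E A = nu A.
  apply: product_measure_unique => A1 A2 mA1 mA2.
  rewrite /nu /= /pushforward /mrestr.
  have mU j : measurable (upd B i A2 j) by rewrite /upd; case: ifP.
  have := H A1 _ mA1 mU; rewrite (eventS _ iJ) (weightS _ iJ).
  rewrite (eq_event (@updP J B i A2)) (eq_weight (@updP J B i A2)) -/E.
  rewrite setIA /upd eqxx EFinM fineK ?fin_num_measure//; last exact: measurable_pre.
  have -> : P (eps i @^-1` A2) = normal_prob 0 sigma A2 by exact: noise.1.
  rewrite (_ : V @^-1` _ = Z @^-1` A1 `&` eps i @^-1` A2)// => ->.
  by rewrite /m1/= /mscale/= muleA muleC muleA.
pose A : set (R * R) := [set z | C (z.1 + u * z.2)].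
have mA : measurable A.
  rewrite -[A]setTI; apply: (_ : measurable_fun [set: R * R] _) mC => //.
  by apply: measurable_funD => //; exact: measurable_funM.
transitivity (nu A); first by [].
rewrite -prodE// -normal_prob_add// /product_measure1 ge0_integral_mscale//.
- by rewrite muleC.
- exact: measurable_fun_xsection.
Qed.

Let normal_off_single i (u : R) : u != 0 ->
  normal_off (fun w => u * eps i w) (u * sigma) [set i]%SET.
Proof.
move=> u0 C B mC mB.
have mC' : measurable ((fun y : R => 0 + u * y) @^-1` C).
  rewrite -[X in measurable X]setTI; apply: (_ : measurable_fun [set: R] _) mC => //.
  by apply: measurable_funD => //; exact: measurable_funM.
pose B' := upd B i ((fun y : R => 0 + u * y) @^-1` C).
have mB' j : measurable (B' j) by rewrite /B' /upd; case: ifP.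
have i0 : i \notin finset.set0 by rewrite inE.
have := noise.2 B' mB'.
have -> : \bigcap_(i in [set: 'I_n]) (eps i @^-1` B' i) = event finset.set0 B'.
  by apply/seteqP; split => w H j _; apply: H => //=; rewrite inE.
have -> : (\prod_(j < n) P (eps j @^-1` B' j))%E = (weight finset.set0 B')%:E.
  rewrite /weight -prodEFin; apply: eq_big => [j|j _]; first by rewrite inE.
  by rewrite fineK// fin_num_measure//; exact: measurable_pre.
rewrite (eventS _ i0) (weightS _ i0).
rewrite (eq_event (@updP _ B i _)) (eq_weight (@updP _ B i _)) finset.setU0.
rewrite /B' /upd eqxx EFinM fineK ?fin_num_measure//; last exact: measurable_pre.
have sig0 : sigma != 0 by rewrite gt_eqF.
have -> : P (eps i @^-1` ((fun y : R => 0 + u * y) @^-1` C)) =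
    normal_prob 0 sigma ((fun y : R => 0 + u * y) @^-1` C) by exact: noise.1.
have := normal_prob_affine 0 0 sig0 u0 mC; rewrite mulr0 addr0 => ->.
move=> <-; congr (P (_ `&` _)); apply/seteqP; split => w; rewrite /= add0r//.
Qed.

Definition combination (u : 'cV[R]_n) (w : T) : R := \sum_i u i 0 * eps i w.

Lemma measurable_combination u : measurable_fun [set: T] (combination u).
Proof.
apply: measurable_sum => i; apply: measurable_funM => //; exact: measurable_eps.
Qed.

Let normal_off_sub (Z : T -> R) (s : R) (J K : {set 'I_n}) :
  J \subset K -> normal_off Z s J -> normal_off Z s K.
Proof.
move=> JK H; have -> : K = J :|: [set x in enum K]%SET.
  by apply/setP => i; rewrite !inE mem_enum; case: (boolP (i \in J)) => // /(fintype.subsetP JK).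
elim: (enum K) => [|i l IH].
  by rewrite (_ : J :|: _ = J)//; apply/setP => i; rewrite !inE orbF.
rewrite (_ : J :|: _ = i |: (J :|: [set x in l])%SET); first exact: normal_off_weaken.
by apply/setP => j; rewrite !inE orbCA.
Qed.

Let combination_off (J : {set 'I_n}) (u : 'cV[R]_n) :
  (forall i, i \notin J -> u i 0 = 0) -> u != 0 ->
  normal_off (combination u) (sigma * Num.sqrt (sqnorm u)) J.
Proof.
have sig0 : sigma != 0 by rewrite gt_eqF.
have [k] := ubnP #|J|; elim: k J u => // k IH J u Jk uJ u0.
have [J0|[i iJ]] := finset.set_0Vmem J.
  case/eqP: u0; apply/matrixP => j l; rewrite ord1 mxE uJ// J0 inE //.
have JDk : (#|J :\ i| < k)%N by move: Jk; rewrite (cardsD1 i J) iJ.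
pose v : 'cV[R]_n := \col_j if j == i then 0 else u j 0.
have vJ j : j \notin J :\ i -> v j 0 = 0.
  by rewrite !inE negb_and negbK mxE => /orP[->//|jJ]; case: ifP => // _; exact: uJ.
have uE : combination u = fun w => combination v w + u i 0 * eps i w.
  apply/funext => w; rewrite /combination (bigD1 i)//= addrC; congr (_ + _).
  rewrite [RHS](bigD1 i)//= mxE eqxx mul0r add0r.
  by apply: eq_bigr => j /negbTE ji; rewrite mxE ji.
have sE : sqnorm u = sqnorm v + u i 0 ^+ 2.
  rewrite /sqnorm (bigD1 i)//= addrC; congr (_ + _).
  rewrite [RHS](bigD1 i)//= mxE eqxx expr0n add0r.
  by apply: eq_bigr => j /negbTE ji; rewrite mxE ji.
have DJ : J :\ i \subset J by exact: finset.subD1set.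
(* [normal_off_step] needs both summands to be nondegenerate, so v = 0 and u i 0 = 0 are treated
   apart. *)
have [v0|v0] := eqVneq v 0.
  have ui0 : u i 0 != 0.
    apply: contra_neq u0 => ui0; apply/matrixP => j l; rewrite ord1 mxE.
    have [->//|ji] := eqVneq j i.
    by have /matrixP/(_ j 0) := v0; rewrite !mxE (negbTE ji).
  have -> : combination u = fun w => u i 0 * eps i w.
    rewrite uE v0; apply/funext => w; rewrite /combination big1 ?add0r// => j _.
    by rewrite mxE mul0r.
  have -> : sigma * Num.sqrt (sqnorm u) = `|u i 0 * sigma|.
    rewrite sE v0 dot_sqnorm dot0l add0r sqrtr_sqr normrM (gtr0_norm sigma_gt0).
    by rewrite mulrC.
  have iJ' : [set i]%SET \subset J by rewrite finset.sub1set.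
  apply: (normal_off_sub iJ') => C B mC mB.
  rewrite normal_prob_abs ?mulf_neq0//; exact: normal_off_single.
have [ui0|ui0] := eqVneq (u i 0) 0.
  have <- : v = u.
    apply/matrixP => j l; rewrite ord1 mxE; case: ifP => // /eqP ->.
    by rewrite ui0.
  by apply: (normal_off_sub DJ); exact: IH.
rewrite uE -(finset.setD1K iJ).
have sv0 : 0 < sqnorm v by rewrite lt_neqAle eq_sym sqnorm_eq0 v0 sqnorm_ge0.
have -> : sigma * Num.sqrt (sqnorm u) =
    Num.sqrt ((sigma * Num.sqrt (sqnorm v)) ^+ 2 + (u i 0 * sigma) ^+ 2).
  rewrite !exprMn sqr_sqrtr ?sqnorm_ge0// [u i 0 ^+ 2 * _]mulrC -mulrDr -sE.
  by rewrite sqrtrM ?sqr_ge0// sqrtr_sqr gtr0_norm.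
apply: normal_off_step => //.
- by rewrite !inE eqxx.
- by rewrite mulf_neq0// sqrtr_eq0 -ltNge.
- exact: measurable_combination.
- exact: IH.
Qed.

Lemma combination_dist (u : 'cV[R]_n) C : u != 0 -> measurable C ->
  P (combination u @^-1` C) = normal_prob 0 (sigma * Num.sqrt (sqnorm u)) C.
Proof.
move=> u0 mC.
have uT i : i \notin finset.setT -> u i 0 = 0 by rewrite inE.
have := @combination_off finset.setT u uT u0 C (fun=> setT) mC (fun=> measurableT).
have -> : event finset.setT (fun=> setT) = setT by apply/seteqP; split.
by rewrite setIT /weight big_pred0 ?mule1 => [|i]; last by rewrite inE.
Qed.

End GaussianCombination.

Section NormalIntegrals.
Context {R : realType}.
Local Notation mu := (@lebesgue_measure R).
Implicit Types (m s t b x z : R).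

Lemma measurable_pdf m s : measurable_fun [set: R] (EFin \o normal_pdf m s).
Proof. by apply/measurable_EFinP; exact: measurable_normal_pdf. Qed.

(** Mills' bound. With z = x + y, the density is at most a constant times the exponential density of
    rate x at y, because (x + y)^2 >= x^2 + 2 x y. The factor 1 / x is essential in
    [failure_bound]. *)
Lemma normal_prob_tail x : 0 < x ->
  (normal_prob 0 1 [set z | x <= z]%R <=
   ((normal_peak 1) / x * expR (- x ^+ 2 / 2))%:E)%E.
Proof.
move=> x0; rewrite /normal_prob integral_mkcond.
have mC : measurable [set z : R | x <= z].
  by rewrite (_ : [set z | _] = `[x, +oo[%classic)//; apply/seteqP; split => z;
    rewrite /= in_itv/= andbT.
have pos z : (0 <= ((EFin \o normal_pdf 0 1) \_ [set z | (x <= z)%R]) z)%E.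
  by rewrite patchE; case: ifP => // _; rewrite lee_fin normal_pdf_ge0.
rewrite (lebesgue_affine x (oner_neq0 R))//; last first.
  by apply/(measurable_restrictT _ mC)/measurable_funTS; exact: measurable_pdf.
rewrite normr1 mul1e.
set K := normal_peak 1 / x * expR (- x ^+ 2 / 2).
have K0 : 0 <= K by rewrite !mulr_ge0 ?expR_ge0 ?normal_peak_ge0 ?invr_ge0 ?ltW.
rewrite -[leRHS]mule1 -(integral_exponential_pdf x0).
have mexp : measurable_fun [set: R] (EFin \o exponential_pdf x).
  by apply/measurable_EFinP; exact: measurable_exponential_pdf.
have epos y : 0 <= exponential_pdf x y by rewrite exponential_pdf_ge0// ltW.
rewrite -ge0_integralZl//=; last by move=> y _; rewrite lee_fin.
apply: ge0_le_integral => //=.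
- apply: (measurableT_comp (f := ((EFin \o normal_pdf 0 1) \_ [set z | (x <= z)%R]))).
    by apply/(measurable_restrictT _ mC)/measurable_funTS; exact: measurable_pdf.
  by apply: measurable_funD => //; exact: measurable_funM.
- by apply: measurable_funeM.
- move=> y _; rewrite patchE mul1r.
  case: ifPn => [/set_mem/=|_]; last by rewrite mule_ge0 ?lee_fin.
  rewrite lerDl => y0.
  rewrite -EFinM lee_fin normal_pdf_def ?oner_neq0// exponential_pdfE//.
  have -> : K * (x * expR (- x * y)) =
      normal_peak 1 * expR (- x ^+ 2 / 2 + - x * y).
    by rewrite expRD /K; field; rewrite gt_eqF.
  rewrite ler_wpM2l ?normal_peak_ge0// ler_expR subr0 expr1n.
  by have := sqr_ge0 y; lra.
Qed.

(** Completing the square: up to a constant, the integrand is the normal density with mean b / (1 -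
    2t) and variance 1 / (1 - 2t). *)
Lemma integral_expR_quad t b : 0 <= t -> t < 2^-1 ->
  (\int[normal_prob 0 1]_z (expR (b * z + t * z ^+ 2))%:E =
   ((Num.sqrt (1 - 2 * t))^-1 * expR (b ^+ 2 / (2 * (1 - 2 * t))))%:E)%E.
Proof.
move=> t0 t2; have t1 : 0 < 1 - 2 * t by lra.
have mf : measurable_fun [set: R] (fun z : R => (expR (b * z + t * z ^+ 2))%:E).
  apply/measurable_EFinP; apply: measurableT_comp => //.
  by apply: measurable_funD; apply: measurable_funM.
rewrite ge0_integral_normal_prob//.
pose r := Num.sqrt (1 - 2 * t).
have r0 : 0 < r by rewrite sqrtr_gt0.
have r2 : r ^+ 2 = 1 - 2 * t by rewrite sqr_sqrtr// ltW.
have rV0 : r^-1 != 0 by rewrite invr_eq0 gt_eqF.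
set K := _ * expR _.
have -> : (fun z => (expR (b * z + t * z ^+ 2))%:E * (normal_pdf 0 1 z)%:E)%E =
    (fun z => K%:E * (normal_pdf (b / r ^+ 2) r^-1 z)%:E)%E.
  apply/funext => z; rewrite -!EFinM !normal_pdf_def ?oner_neq0//; congr EFin.
  have -> : (Num.sqrt (r^-1 ^+ 2 * pi *+ 2))^-1 = r * (Num.sqrt (1 ^+ 2 * pi *+ 2))^-1.
    rewrite -mulrnAr sqrtrM ?sqr_ge0// sqrtr_sqr ger0_norm ?invr_ge0 ?ltW//.
    by rewrite invfM invrK expr1n mul1r.
  have cancel_r (e e' c : R) : r^-1 * e * (r * c * e') = c * (e * e').
    by field; rewrite gt_eqF.
  rewrite mulrCA -expRD /K -/r cancel_r -expRD.
  congr (_ * expR _); rewrite -r2.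
  have -> : t * z ^+ 2 = (1 - r ^+ 2) / 2 * z ^+ 2 by rewrite r2; field.
  field.
  by rewrite gt_eqF.
rewrite ge0_integralZl//=.
- by rewrite integral_normal_pdf mule1.
- exact: measurable_pdf.
- by move=> z _; rewrite lee_fin normal_pdf_ge0.
- by rewrite lee_fin mulr_ge0 ?expR_ge0// invr_ge0 sqrtr_ge0.
Qed.

End NormalIntegrals.

Lemma integral_probability_cst d (T : measurableType d) (R : realType)
  (P : probability T R) (r : \bar R) : (\int[P]_w r = r)%E.
Proof.
have -> : (\int[P]_w r = r * P setT)%E by exact: integral_cst.
by rewrite probability_setT mule1.
Qed.

Section GaussianTails.
Context {R : realType} (d : measure_display) (T : measurableType d).
Context (P : probability T R) (n : nat) (sigma : R).
Context (eps : 'I_n -> {RV P >-> R}).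
Hypothesis sigma_gt0 : 0 < sigma.
Hypothesis noise : gaussian_noise sigma eps.
Local Notation comb := (combination eps).

Lemma combination_dot (u : 'cV[R]_n) w : comb u w = dot u (\col_i eps i w).
Proof. by apply: eq_bigr => i _; rewrite mxE. Qed.

Lemma normal_prob_scale (s : R) (C : set R) : s != 0 -> measurable C ->
  normal_prob 0 s C = normal_prob 0 1 [set z | C (s * z)].
Proof.
move=> s0 mC; have := normal_prob_affine 0 0 (oner_neq0 R) s0 mC.
rewrite mulr0 addr0 mulr1 => <-; congr (normal_prob _ _ _).
by apply/seteqP; split => z; rewrite /= add0r.
Qed.

Lemma integral_combination (u : 'cV[R]_n) (f : R -> \bar R) :
  measurable_fun [set: R] f -> (forall x, (0 <= f x)%E) ->
  (\int[P]_w f (comb u w) =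
   \int[normal_prob 0 1]_z f (sigma * Num.sqrt (sqnorm u) * z)%R)%E.
Proof.
move=> mf f0; have [->|u0] := eqVneq u 0.
  have s0 : sqnorm (0 : 'cV[R]_n) = 0 by rewrite dot_sqnorm dot0l.
  under eq_integral do rewrite combination_dot dot0l.
  under [RHS]eq_integral do rewrite s0 sqrtr0 mulr0 mul0r.
  by rewrite !integral_probability_cst.
set s := sigma * _.
have s0 : s != 0 by rewrite mulf_neq0 ?gt_eqF// sqrtr_gt0 lt_neqAle eq_sym sqnorm_eq0 u0 sqnorm_ge0.
have mc : measurable_fun [set: T] (comb u : T -> measurableTypeR R).
  exact: measurable_combination.
have ms : measurable_fun [set: measurableTypeR R] ( *%R s : measurableTypeR R -> measurableTypeR R).
  exact: measurable_funM.
transitivity (\int[image_measure P mc]_x f x)%E.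
  by rewrite ge0_integral_pushforward.
transitivity (\int[image_measure (normal_prob 0 1) ms]_x f x)%E.
  apply: eq_measure_integral => A mA _; rewrite /= /pushforward.
  by rewrite (combination_dist sigma_gt0 noise u0 mA) normal_prob_scale.
by rewrite ge0_integral_pushforward.
Qed.

Lemma normal_mgf (b : R) :
  (\int[normal_prob 0 1]_z (expR (b * z))%:E = (expR (b ^+ 2 / 2))%:E)%E.
Proof.
have half_gt0 : (0 : R) < 2^-1 by rewrite invr_gt0.
have := integral_expR_quad b (lexx 0) half_gt0.
under eq_integral do rewrite mul0r addr0.
by rewrite mulr0 subr0 sqrtr1 invr1 mul1r mulr1.
Qed.

Lemma combination_mgf (u : 'cV[R]_n) :
  (\int[P]_w (expR (comb u w))%:E = (expR (sigma ^+ 2 * sqnorm u / 2))%:E)%E.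
Proof.
rewrite (integral_combination u (f := fun x => (expR x)%:E)).
- by rewrite normal_mgf exprMn sqr_sqrtr// sqnorm_ge0.
- by apply/measurable_EFinP; exact: measurable_expR.
- by move=> x; rewrite lee_fin expR_ge0.
Qed.

(* [exp (t x^2)] is the Gaussian average of [exp (sqrt (2 t) z x)], which turns
   the expectation of a quadratic exponential into one of a linear one. *)
Lemma quadratic_mgf (t : R) (us : seq 'cV[R]_n) (a : 'cV[R]_n) :
  0 <= t -> t < 2^-1 ->
  pairwise (fun u v => dot u v == 0) us -> all (fun u => sqnorm u == 1) us ->
  (\int[P]_w (expR (comb a w + t / sigma ^+ 2 * \sum_(u <- us) comb u w ^+ 2))%:E =
   ((Num.sqrt (1 - 2 * t))^-1 ^+ size us *
     expR (sigma ^+ 2 / 2 * (sqnorm a +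
       2 * t / (1 - 2 * t) * \sum_(u <- us) dot u a ^+ 2)))%:E)%E.
Proof.
move=> t0 t2; have t1 : 0 < 1 - 2 * t by lra.
have sig0 : sigma != 0 by rewrite gt_eqF.
(* The linear term [a] is there for the induction: removing [u] adds a random multiple of [u] to
   it. *)
elim: us a => [|u us IH] a /=.
  move=> _ _; under eq_integral do rewrite big_nil mulr0 addr0.
  rewrite combination_mgf expr0 mul1r big_nil mulr0 addr0; congr (expR _)%:E; ring.
move=> /andP[/allP uus pus] /andP[/eqP u1 aus].
(* Chosen so that the average of exp(c x z) over z is exp(t x^2 / sigma^2). *)
pose c := Num.sqrt (2 * t) / sigma.
have c2 : c ^+ 2 = 2 * t / sigma ^+ 2 by rewrite expr_div_n sqr_sqrtr//; lra.
pose g (wz : T * R) : \bar R := (expR (comb (a + (c * wz.2) *: u) wz.1 +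
  t / sigma ^+ 2 * \sum_(v <- us) comb v wz.1 ^+ 2))%:E.
have combE wz : comb (a + (c * wz.2) *: u) wz.1 = comb a wz.1 + c * wz.2 * comb u wz.1.
  by rewrite !combination_dot dotDl dotZl.
have mcomb v : measurable_fun [set: T * R] (fun wz => comb v wz.1).
  by apply: measurableT_comp => //; exact: measurable_combination.
have mg : measurable_fun [set: T * R] g.
  apply/measurable_EFinP; apply: measurableT_comp => //.
  apply: measurable_funD.
    under eq_fun do rewrite combE.
    apply: measurable_funD => //; apply: measurable_funM => //.
    by apply: measurable_funM.
  apply: measurable_funM => //; apply: measurable_sum => v.
  exact: measurable_funX.
have g0 wz : (0 <= g wz)%E by rewrite lee_fin expR_ge0.
transitivity (\int[P]_w \int[normal_prob 0 1]_z g (w, z))%E.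
  apply: eq_integral => w _.
  pose K := expR (comb a w + t / sigma ^+ 2 * \sum_(v <- us) comb v w ^+ 2).
  transitivity (\int[normal_prob 0 1]_z (K%:E * (expR (c * comb u w * z))%:E))%E.
    rewrite ge0_integralZl//=; last 2 first.
    - by apply/measurable_EFinP; apply: measurableT_comp => //; exact: measurable_funM.
    - by rewrite lee_fin expR_ge0.
    rewrite normal_mgf -EFinM -expRD; congr (expR _)%:E.
    by rewrite big_cons exprMn c2; field.
  apply: eq_integral => z _; rewrite /g combE -EFinM -expRD; congr (expR _)%:E.
  by rewrite /=; ring.
transitivity (\int[normal_prob 0 1]_z \int[P]_w g (w, z))%E.
  exact: (@fubini_tonelli _ _ _ _ R P (normal_prob 0 1) g mg g0).
pose K := (Num.sqrt (1 - 2 * t))^-1 ^+ size us * expR (sigma ^+ 2 / 2 *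
  (sqnorm a + 2 * t / (1 - 2 * t) * \sum_(v <- us) dot v a ^+ 2)).
pose b := sigma ^+ 2 * c * dot u a.
transitivity (\int[normal_prob 0 1]_z (K%:E * (expR (b * z + t * z ^+ 2))%:E))%E.
  apply: eq_integral => z _; rewrite /g/= IH// -EFinM; congr EFin.
  rewrite /K -[RHS]mulrA -expRD; congr (_ * expR _).
  (* By orthogonality the shift along [u] is not seen by the other vectors. *)
  have -> : \sum_(v <- us) dot v (a + (c * z) *: u) ^+ 2 = \sum_(v <- us) dot v a ^+ 2.
    rewrite big_seq [RHS]big_seq; apply: eq_bigr => v /uus /eqP uv.
    by rewrite dotDr dotZr (dotC v u) uv mulr0 addr0.
  have -> : t * z ^+ 2 = sigma ^+ 2 * c ^+ 2 / 2 * z ^+ 2 by rewrite c2; field.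
  rewrite sqnormD dotZr (dotC a u) sqnormZ u1 mulr1 exprMn /b.
  by field; rewrite gt_eqF.
rewrite ge0_integralZl//=; last 2 first.
- apply/measurable_EFinP; apply: measurableT_comp => //.
  by apply: measurable_funD; apply: measurable_funM.
- by rewrite lee_fin mulr_ge0 ?expR_ge0// exprn_ge0// invr_ge0 sqrtr_ge0.
rewrite integral_expR_quad// -EFinM /K mulrACA -expRD -exprSr; congr (_ * expR _)%:E.
have -> : b ^+ 2 = 2 * t * sigma ^+ 2 * dot u a ^+ 2.
  have -> : b ^+ 2 = sigma ^+ 2 ^+ 2 * c ^+ 2 * dot u a ^+ 2 by rewrite /b; ring.
  by rewrite c2; field.
rewrite big_cons; field.
by rewrite gt_eqF.
Qed.

Lemma measurable_ge_set (x : R) : measurable [set z : R | x <= z].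
Proof.
rewrite (_ : [set z | _] = `[x, +oo[%classic)//.
by apply/seteqP; split => z; rewrite /= in_itv/= andbT.
Qed.

Lemma measurable_norm_ge (x : R) : measurable [set z : R | x <= `|z|].
Proof.
rewrite -[X in measurable X]setTI.
by apply: (_ : measurable_fun [set: R] (@Num.norm R R)) (measurable_ge_set x).
Qed.

Lemma normal_prob_norm_tail (x : R) : 0 < x ->
  (normal_prob 0 1 [set z | x <= `|z|]%R <=
   (2 * normal_peak 1 / x * expR (- x ^+ 2 / 2))%:E)%E.
Proof.
move=> x0.
have -> : [set z : R | x <= `|z|] = [set z | x <= z] `|` [set z | x <= -1 * z].
  by apply/seteqP; split => z /=; rewrite mulN1r ler_normr => /orP.
have mneg : measurable [set z : R | x <= -1 * z].
  rewrite -[X in measurable X]setTI.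
  by apply: (_ : measurable_fun [set: R] ( *%R (-1))) (measurable_ge_set x).
have n1 : (-1 : R) != 0 by rewrite oppr_eq0 oner_eq0.
apply: (@le_trans _ _ (normal_prob 0 1 [set z : R | (x <= z)%R] +
    normal_prob 0 1 [set z : R | (x <= -1 * z)%R])%E).
  by apply: measureU2 => //; exact: measurable_ge_set.
have -> : normal_prob 0 1 [set z : R | x <= -1 * z] = normal_prob 0 1 [set z | x <= z].
  have scale := normal_prob_scale n1 (measurable_ge_set x).
  have := normal_prob_abs 0 [set z : R | x <= z] n1; rewrite normrN1 => abs.
  transitivity (normal_prob 0 (-1) [set z : R | x <= z]).
    exact: esym scale.
  exact: esym abs.
have := normal_prob_tail x0; set K := (X in (_ <= X%:E)%E) => KE.
have -> : 2 * normal_peak 1 / x * expR (- x ^+ 2 / 2) = K + K.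
  by rewrite /K; ring.
by rewrite EFinD; exact: leeD.
Qed.

Lemma combination_tail (u : 'cV[R]_n) (r x : R) : 0 < r -> 0 < x ->
  sqnorm u <= r ^+ 2 ->
  (P [set w | x * sigma * r <= `|comb u w| ]%R <=
   (2 * normal_peak 1 / x * expR (- x ^+ 2 / 2))%:E)%E.
Proof.
move=> r0 x0 ur; have [->|u0] := eqVneq u 0.
  rewrite [X in P X](_ : _ = set0) ?measure0.
    by rewrite lee_fin !mulr_ge0 ?normal_peak_ge0 ?expR_ge0// invr_ge0 ltW.
  apply/seteqP; split => w //=; rewrite combination_dot dot0l normr0.
  by rewrite leNgt !mulr_gt0.
have su : 0 < sqnorm u by rewrite lt_neqAle eq_sym sqnorm_eq0 u0 sqnorm_ge0.
pose s := sigma * Num.sqrt (sqnorm u).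
have s0 : 0 < s by rewrite mulr_gt0// sqrtr_gt0.
have mC := measurable_norm_ge (x * s).
have mpre : measurable (comb u @^-1` [set y | x * s <= `|y|]).
  by rewrite -[X in measurable X]setTI; exact: measurable_combination.
apply: (@le_trans _ _ (P (comb u @^-1` [set y | x * s <= `|y|]))).
  apply: le_measure; rewrite ?inE//.
    rewrite -[X in measurable X]setTI.
    exact: (measurable_combination eps u measurableT (measurable_norm_ge (x * sigma * r))).
  move=> w /=; apply: le_trans; rewrite /s -mulrA ler_pM2l// ler_pM2l//.
  by rewrite -[leRHS](gtr0_norm r0) -sqrtr_sqr ler_sqrt ?sqr_ge0.
rewrite (combination_dist sigma_gt0 noise u0 mC) (normal_prob_scale (s := s))//; last first.
  by rewrite gt_eqF.
have -> : [set z : R | [set y | x * s <= `|y|] (s * z)] = [set z | x <= `|z|].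
  by apply/seteqP; split => z /=; rewrite normrM gtr0_norm// mulrC ler_pM2l.
exact: normal_prob_norm_tail.
Qed.

(** Exponential Markov inequality. Fewer than [m] vectors are allowed, since orthonormalization may
    drop some; each missing one only loses a factor sqrt Z >= 1. *)
Lemma chi_square_tail (m : nat) (Z : R) (us : seq 'cV[R]_n) :
  (size us <= m)%N -> 1 <= Z ->
  pairwise (fun u v => dot u v == 0) us -> all (fun u => sqnorm u == 1) us ->
  (P [set w | m%:R * Z * sigma ^+ 2 <= \sum_(u <- us) comb u w ^+ 2 ]%R <=
   (expR (- (m%:R / 2 * (Z - 1 - ln Z))))%:E)%E.
Proof.
move=> um Z1 orth unit_us; have Z0 : 0 < Z by lra.
have s2 : 0 < sigma ^+ 2 by rewrite exprn_gt0.
(* The minimizer of - t m Z - (m / 2) ln(1 - 2 t). *)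
pose t := (1 - Z^-1) / 2.
have ZV0 : 0 < Z^-1 by rewrite invr_gt0.
have ZV1 : Z^-1 <= 1 by rewrite invf_le1.
have t0 : 0 <= t by rewrite /t; lra.
have t2 : t < 2^-1 by rewrite /t; lra.
have tE : 1 - 2 * t = Z^-1 by rewrite /t; field; rewrite gt_eqF.
pose S w := \sum_(u <- us) comb u w ^+ 2.
have mS : measurable_fun [set: T] S.
  apply: measurable_sum => u; apply: measurable_funX; exact: measurable_combination.
have mA : measurable [set w | m%:R * Z * sigma ^+ 2 <= S w].
  by rewrite -[X in measurable X]setTI; exact: (mS measurableT _ (measurable_ge_set _)).
have := @quadratic_mgf t us 0 t0 t2 orth unit_us.
have -> : \sum_(u <- us) dot u (0 : 'cV[R]_n) ^+ 2 = 0.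
  by apply: big1 => u _; rewrite dot0r expr0n.
rewrite dot_sqnorm dot0l !mulr0 addr0 mulr0 expR0 mulr1 tE.
rewrite (_ : (Num.sqrt Z^-1)^-1 = Num.sqrt Z); last by rewrite sqrtrV ?invrK ?ltW.
under eq_integral do rewrite combination_dot dot0l add0r -/(S _).
move=> mgf.
pose K := expR (- (t * m%:R * Z)).
have mK : measurable_fun [set: T] (fun w => (K * expR (t / sigma ^+ 2 * S w))%:E).
  apply/measurable_EFinP; apply: measurable_funM => //.
  by apply: measurableT_comp => //; exact: measurable_funM.
rewrite -[X in P X]setIT -integral_indic//.
apply: (@le_trans _ _ (\int[P]_w (K * expR (t / sigma ^+ 2 * S w))%:E)%E).
  apply: ge0_le_integral => //.
  - by apply/measurable_EFinP; exact: measurable_indic.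
  - move=> w _; rewrite lee_fin indicE; case: (boolP (w \in _)) => [/set_mem /= Sw|_] /=.
      rewrite -expRD -[leLHS]expR0 ler_expR.
      have -> : - (t * m%:R * Z) + t / sigma ^+ 2 * S w =
          t * (S w / sigma ^+ 2 - m%:R * Z) by field; rewrite gt_eqF.
      by rewrite mulr_ge0// subr_ge0 ler_pdivlMr.
    by rewrite mulr_ge0 ?expR_ge0.
under eq_integral do rewrite EFinM.
rewrite ge0_integralZl//= ?mgf//; last 2 first.
  - apply/measurable_EFinP; apply: measurableT_comp => //.
    exact: measurable_funM.
  - by rewrite lee_fin expR_ge0.
rewrite -EFinM lee_fin.
have sqrtZ : Num.sqrt Z = expR (ln Z / 2).
  rewrite -[expR _]ger0_norm ?expR_ge0// -sqrtr_sqr -expRM_natl mulrC divfK//.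
  by rewrite lnK// posrE.
have sqrtZ1 : 1 <= Num.sqrt Z by rewrite -[leLHS]sqrtr1 ler_sqrt ?(ltW Z0).
apply: (@le_trans _ _ (K * Num.sqrt Z ^+ m)).
  by rewrite ler_wpM2l ?expR_ge0// ler_weXn2l.
rewrite sqrtZ -expRM_natl -expRD ler_expR le_eqVlt; apply/orP; left; apply/eqP.
by rewrite /t; field; rewrite gt_eqF.
Qed.

End GaussianTails.

(** * The good event *)

Section Orthonormal.
Context {R : realType} (n : nat).
Implicit Types (us : seq 'cV[R]_n) (z e : 'cV[R]_n).

Definition orthonormal us :=
  pairwise (fun u v => dot u v == 0) us && all (fun u => sqnorm u == 1) us.

(** For orthonormal [us], membership in their span. *)
Definition expands us z := z = \sum_(u <- us) dot u z *: u.

Lemma expandsD us z z' : expands us z -> expands us z' -> expands us (z + z').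
Proof.
move=> ez ez'; rewrite /expands {1}ez {1}ez' -big_split; apply: eq_bigr => u _.
by rewrite dotDr scalerDl.
Qed.

Lemma expandsZ us c z : expands us z -> expands us (c *: z).
Proof.
move=> ez; rewrite /expands {1}ez scaler_sumr; apply: eq_bigr => u _.
by rewrite dotZr scalerA.
Qed.

Lemma expands0 us : expands us 0.
Proof. by rewrite /expands big1// => u _; rewrite dot0r scale0r. Qed.

Lemma expands_dot us z e : expands us z ->
  dot z e = \sum_(u <- us) dot u z * dot u e.
Proof.
by move=> ez; rewrite {1}ez dot_suml; apply: eq_bigr => u _; rewrite dotZl.
Qed.

Lemma orthonormal_sum (V : lmodType R) us u (F : 'cV[R]_n -> V) :
  orthonormal us -> u \in us -> \sum_(v <- us) dot v u *: F v = F u.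
Proof.
move=> /andP[]; elim: us => // v us IH /= /andP[/allP vus orth] /andP[/eqP v1 unit_us].
rewrite inE big_cons => /orP[/eqP ->|uus].
  rewrite -dot_sqnorm v1 scale1r big_seq big1 ?addr0// => u' /vus /eqP.
  by rewrite dotC => ->; rewrite scale0r.
by rewrite (eqP (vus _ uus)) scale0r add0r IH.
Qed.

Lemma orthonormal_coord us u (c : 'cV[R]_n -> R) : orthonormal us -> u \in us ->
  \sum_(v <- us) c v * dot u v = c u.
Proof.
move=> on uus; rewrite -[RHS](@orthonormal_sum R^o us u c on uus).
by apply: eq_bigr => v _; rewrite mulrC dotC.
Qed.

Lemma dot_sumr us u (c : 'cV[R]_n -> R) :
  dot u (\sum_(v <- us) c v *: v) = \sum_(v <- us) c v * dot u v.
Proof. by rewrite dotC dot_suml; apply: eq_bigr => v _; rewrite dotZl dotC. Qed.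

Lemma expands_span us (c : 'cV[R]_n -> R) : orthonormal us ->
  expands us (\sum_(v <- us) c v *: v).
Proof.
move=> on; apply: eq_big_seq => v vus.
by rewrite dot_sumr orthonormal_coord.
Qed.

Lemma gram_schmidt (zs : seq 'cV[R]_n) : exists us,
  [/\ (size us <= size zs)%N, orthonormal us & {in zs, forall z, expands us z}].
Proof.
elim: zs => [|z zs [us [us_size us_on us_zs]]]; first by exists [::]; split.
pose r := z - \sum_(u <- us) dot u z *: u.
have orth u : u \in us -> dot u r = 0.
  by move=> uus; rewrite dotBr dot_sumr orthonormal_coord// subrr.
have [r0|r0] := eqVneq r 0.
  exists us; split=> //; first exact: ltnW.
  move=> z'; rewrite inE => /orP[/eqP ->|/us_zs//].
  by apply/eqP; rewrite -subr_eq0 -/r r0.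
have sr : 0 < sqnorm r by rewrite lt_neqAle eq_sym sqnorm_eq0 r0 sqnorm_ge0.
pose v := (Num.sqrt (sqnorm r))^-1 *: r.
have v1 : sqnorm v = 1 by rewrite sqnormZ exprVn sqr_sqrtr ?ltW// mulVf ?gt_eqF.
have orthv u : u \in us -> dot v u = 0.
  by move=> /orth ur; rewrite dotZl dotC ur mulr0.
have ext z' : expands us z' -> dot v z' = 0 -> expands (v :: us) z'.
  by move=> ez vz; rewrite /expands big_cons vz scale0r add0r.
exists (v :: us); split=> //.
- rewrite /orthonormal /= v1 eqxx/=; move/andP: (us_on) => [-> ->]; rewrite !andbT.
  by apply/allP => u /orthv ->.
- move=> z'; rewrite inE => /orP[/eqP ->|zz]; last first.
    apply: ext; first exact: us_zs.
    rewrite dotC (expands_dot _ (us_zs _ zz)) big_seq big1// => u uus.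
    by rewrite (dotC u v) orthv// mulr0.
  have -> : z = Num.sqrt (sqnorm r) *: v + \sum_(u <- us) dot u z *: u.
    rewrite scalerA mulfV ?scale1r; last by rewrite gt_eqF// sqrtr_gt0.
    by rewrite subrK.
  apply: expandsD.
    apply: expandsZ; rewrite /expands big_cons -dot_sqnorm v1 scale1r big_seq.
    by rewrite big1 ?addr0// => u /orthv vu; rewrite dotC vu scale0r.
  apply: ext; first exact: expands_span.
  rewrite dot_sumr big_seq big1// => u uus; by rewrite orthv// mulr0.
Qed.

(** Cauchy-Schwarz after replacing [e] by its projection on the span. *)
Lemma dot_sqr_le_coords us z e : orthonormal us -> expands us z ->
  dot z e ^+ 2 <= sqnorm z * \sum_(u <- us) dot u e ^+ 2.
Proof.
move=> on ez; pose e' := \sum_(u <- us) dot u e *: u.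
have coord u : u \in us -> dot u e' = dot u e.
  by move=> uus; rewrite dot_sumr orthonormal_coord.
have -> : dot z e = dot z e'.
  by rewrite !(expands_dot _ ez); apply: eq_big_seq => u uus; rewrite coord.
have -> : \sum_(u <- us) dot u e ^+ 2 = sqnorm e'.
  rewrite dot_sqnorm (expands_dot _ (expands_span _ on)).
  by apply: eq_big_seq => u uus; rewrite !coord// expr2.
exact: dot_sqr_le.
Qed.

End Orthonormal.

Section Residuals.
Context {R : realType} (n p : nat) (X : 'M[R]_(n, p)).
Context (d : nat) (clo chi : R) (A : {set 'I_p}).
Hypotheses (n_gt0 : (0 < n)%N) (clo_gt0 : 0 < clo).
Hypothesis src : sparse_eigen_bounds X d clo chi.
Hypothesis Ad : (#|A| <= d)%N.

Let n0 : n%:R != 0 :> R. Proof. by rewrite pnatr_eq0 -lt0n. Qed.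

(* [X *m residual j] is the residual of the column [j] after regression on [A]. *)
Definition residual (j : 'I_p) : 'cV[R]_p :=
  delta_mx j 0 - nsolve X A (corr X (delta_mx j 0)).

Lemma residual_supported j : supported (j |: A) (residual j).
Proof.
apply: supportedB.
  by move=> k; rewrite !inE negb_or mxE => /andP[/negbTE -> _].
exact: supportedS (finset.subsetUr _ _) (nsolve_supported _ _).
Qed.

Lemma corr_residual j : {in A, forall k, corr X (residual j) k 0 = 0}.
Proof.
move=> k kA; rewrite /residual -scaleN1r corrD corrZ [LHS]mxE [X in _ + X]mxE.
by rewrite (corr_nsolve clo_gt0 src)// mulN1r subrr.
Qed.

Lemma gdot_orth z b : {in A, forall k, corr X z k 0 = 0} -> supported A b ->
  gdot X z b = 0.
Proof.
move=> zA sb; rewrite gdot_corr (dot_supported (u := 0) sb) ?dot0l// => k kA.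
by rewrite zA// mxE.
Qed.

Lemma dotX_orth z b : {in A, forall k, corr X z k 0 = 0} -> supported A b ->
  dot (X *m z) (X *m b) = 0.
Proof.
move=> zA sb; have /eqP := gdot_orth zA sb.
by rewrite /gdot mulf_eq0 invr_eq0 (negbTE n0) orbF => /eqP.
Qed.

Lemma sqnorm_residual_le j :
  sqnorm (X *m residual j) <= sqnorm (col j X).
Proof.
have sn : supported A (nsolve X A (corr X (delta_mx j 0))) by exact: nsolve_supported.
have -> : col j X = X *m residual j + X *m nsolve X A (corr X (delta_mx j 0)).
  by rewrite -mulmxDr subrK colE.
rewrite sqnormD (dotX_orth (@corr_residual j) sn) mulr0 addr0 lerDl.
exact: sqnorm_ge0.
Qed.

(** The residual of [y] is orthogonal to the columns in [A], so column j may be replaced by its own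
    residual, which in turn is orthogonal to the fit. The score thus becomes a linear form in [y]
    that ignores the signal. *)
Lemma score_oracle_residual y j : score X y (oracle_lse X y A) j =
  dot (X *m residual j) y / n%:R.
Proof.
set o := oracle_lse X y A.
have so : supported A o.
  by rewrite /o (oracle_lseE n_gt0 clo_gt0 src)//; exact: nsolve_supported.
have o0 k : k \in A -> score X y o k = 0.
  move=> kA; rewrite score_corr /o (oracle_lseE n_gt0 clo_gt0 src)//.
  by rewrite (corr_nsolve clo_gt0 src)// [X in _ - X]mxE mulrC subrr.
have scoreE b : dot (X *m b) (y - X *m o) = n%:R * dot b (\col_k score X y o k).
  rewrite dot_mulmx mulr_sumr; apply: eq_bigr => k _.
  by rewrite [X in _ = _ * (_ * X)]mxE /score mulrCA [n%:R * _]mulrC divfK.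
have -> : dot (X *m residual j) y = dot (X *m residual j) (y - X *m o).
  by rewrite dotBr (dotX_orth (@corr_residual j) so) subr0.
rewrite scoreE dotBl [X in _ * (_ - X)]dotC.
have sn : supported A (nsolve X A (corr X (delta_mx j 0))) by exact: nsolve_supported.
rewrite [X in _ * (_ - X)](dot_supported (u := 0) sn); last first.
  by move=> k kA; rewrite !mxE o0.
rewrite dot0l subr0 mulrC mulKf// /dot (bigD1 j)//= big1 => [|k kj].
  by rewrite !mxE !eqxx mul1r addr0.
by rewrite !mxE (negbTE kj) mul0r.
Qed.

(** Such a [z] is the combination of the residuals of [B1] with its own entries as coefficients: the
    difference is supported by [A] and orthogonal to [A], hence zero. So there are at most #|B1|
    degrees of freedom, not #|A| + #|B1|. *)
Lemma residual_basis (B1 : {set 'I_p}) : (forall j, j \in A -> j \notin B1) ->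
  exists us, [/\ (size us <= #|B1|)%N, orthonormal us &
    forall z, supported (A :|: B1) z -> {in A, forall j, corr X z j 0 = 0} ->
      expands us (X *m z)].
Proof.
move=> AB1.
have [us [us_size us_on us_zs]] := gram_schmidt [seq X *m residual j | j <- enum B1].
exists us; split=> //; first by rewrite (leq_trans us_size)// size_map -cardE.
move=> z sz zA; pose z' := \sum_(j in B1) z j 0 *: residual j.
have sz' : supported (A :|: B1) z'.
  rewrite /z'; elim/big_ind: _ => [j _|a b|j jB1]; first by rewrite mxE.
  - exact: supportedD.
  - apply/supportedZ/supportedS/residual_supported.
    by rewrite finset.setUC finset.setUS// finset.sub1set.
have z'A : {in A, forall j, corr X z' j 0 = 0}.
  move=> k kA; rewrite /z'; elim/big_ind: _ => [|a b ha hb|j jB1].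
  - by rewrite /corr !mulmx0 scaler0 mxE.
  - by rewrite corrD mxE ha hb addr0.
  - by rewrite corrZ mxE corr_residual// mulr0.
have -> : z = z'.
  apply/eqP; rewrite -subr_eq0; apply/eqP.
  have sA : supported A (z - z').
    move=> j jA; have [jB1|jB1] := boolP (j \in B1); last first.
      by rewrite (supportedB sz sz')// inE negb_or jA.
    have res k : residual k j 0 = (j == k)%:R.
      by rewrite [LHS]mxE [X in _ + X]mxE nsolve_supported// subr0 mxE eqxx andbT.
    have z'j : z' j 0 = z j 0.
      rewrite summxE (bigD1 j)//= [X in _ + X]big1 => [|k /andP[_ kj]].
        by rewrite mxE res eqxx mulr1 addr0.
      by rewrite mxE res eq_sym (negbTE kj) mulr0.
    by rewrite mxE [X in _ + X]mxE z'j subrr.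
  apply: (sqnorm_eq0_of_src clo_gt0 src Ad sA); rewrite gdot_orth// => j jA.
  by rewrite -scaleN1r corrD corrZ [LHS]mxE [X in _ + X]mxE zA// z'A// mulr0 addr0.
rewrite /z' mulmx_sumr; elim/big_ind: _ => [|a b|j jB1].
- exact: expands0.
- exact: expandsD.
- rewrite -scalemxAr; apply: expandsZ; apply: us_zs.
  by apply: map_f; rewrite mem_enum.
Qed.

End Residuals.

Lemma union_bound d (T : measurableType d) (R : realType) (P : probability T R)
    (I : eqType) (s : seq I) (E : I -> set T) (c : R) : 0 <= c ->
  {in s, forall i, measurable (E i) /\ (P (E i) <= c%:E)%E} ->
  exists U, [/\ measurable U, {in s, forall i, E i `<=` U} &
    (P U <= ((size s)%:R * c)%:E)%E].
Proof.
move=> c0; elim: s => [_|i s IH Es].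
  by exists classical_sets.set0; split=> //; rewrite measure0 mul0r.
have [j js|U [mU EU PU]] := IH; first by apply: Es; rewrite inE js orbT.
have [mE PE] := Es i (mem_head _ _).
exists (E i `|` U); split; first exact: measurableU.
- move=> j; rewrite inE => /orP[/eqP ->|/EU EjU]; first exact: subsetUl.
  exact: subset_trans EjU (@subsetUr _ _ _).
- apply: (le_trans (measureU2 P mE mU)).
  by rewrite /= -natr1 mulrDl mul1r addrC EFinD leeD.
Qed.

(** * Failure rates *)

Section Rates.
Context {R : realType}.

(* The slack of [x - 1 - ln x] when [x] is inflated by the factor 9/8. *)
Definition chernoff_gap : R := 8^-1 - ln (9 / 8).

Lemma chernoff_gap_gt0 : 0 < chernoff_gap.
Proof.
rewrite subr_gt0 -ltr_expR lnK ?posrE; last by lra.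
by have := @expR_gt1Dx R 8^-1; lra.
Qed.

(* The two terms come from the Gaussian tails at [sqrt (2 ln k)] and from the
   chi-square tails. *)
Definition failure_bound (k : nat) : R :=
  4 * normal_peak 1 / Num.sqrt (2 * ln k%:R) + expR (- (k%:R / 4 * chernoff_gap)).

Lemma ln_natr_gt0 (k : nat) : (1 < k)%N -> 0 < ln k%:R :> R.
Proof. by move=> k1; rewrite ln_gt0// ltr1n. Qed.

(** At sqrt(2 ln k) the exponential equals 1 / k and pays for the N <= k events. *)
Lemma gaussian_union_le (N k : nat) : (1 < k)%N -> (N <= k)%N ->
  N%:R * (2 * normal_peak 1 / Num.sqrt (2 * ln k%:R) *
    expR (- Num.sqrt (2 * ln k%:R) ^+ 2 / 2)) <=
  2 * normal_peak 1 / Num.sqrt (2 * ln k%:R) :> R.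
Proof.
move=> k1 Nk; have l0 := ln_natr_gt0 k1.
have k0 : 0 < k%:R :> R by rewrite ltr0n ltnW.
rewrite sqr_sqrtr ?mulr_ge0 ?(ltW l0)// (_ : - (2 * _) / 2 = - ln k%:R); last by field.
rewrite expRN lnK ?posrE// mulrCA ler_piMr//.
  by rewrite !mulr_ge0 ?normal_peak_ge0// invr_ge0 sqrtr_ge0.
by rewrite ler_pdivrMr// mul1r ler_nat.
Qed.

Lemma ptilde1_ge1 (p d m : nat) (q : R) : is_ptilde1 p d m q -> 1 <= 2 * ln q.
Proof.
move=> [_ eq _]; have e0 := expR_gt0 (1 : R).
have s0 : 0 < Num.sqrt (expR 1) :> R by rewrite sqrtr_gt0.
have q0 : 0 < q by exact: lt_le_trans eq.
rewrite -ler_expR mulrC -[_ * 2]/(ln q * 2%:R) expRM_natr lnK ?posrE//.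
by rewrite -(sqr_sqrtr (ltW e0)) ler_pXn2r// nnegrE ltW.
Qed.

(** With z = 2 ln q, the logarithm of the binomial is m/2 (z - 1 - ln z) by definition of q. The
    exponent at 9z/8 exceeds it by m/2 (z/8 - ln(9/8)), and z >= 1. *)
Lemma ptilde1_union_le (p d m : nat) (q : R) (Z := 9 / 8 * (2 * ln q)) :
  is_ptilde1 p d m q ->
  'C(p - d, m)%:R * expR (- (m%:R / 2 * (Z - 1 - ln Z))) <=
  expR (- (m%:R / 2 * chernoff_gap)).
Proof.
move=> pt; have z1 := ptilde1_ge1 pt; have [/andP[m0 mp] _ eq] := pt.
have C0 : 0 < 'C(p - d, m)%:R :> R by rewrite ltr0n bin_gt0.
have mR : 0 < m%:R :> R by rewrite ltr0n.
have z0 : 0 < 2 * ln q by lra.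
have c0 : 0 < 9 / 8 :> R by lra.
have lnZ : ln Z = ln (9 / 8) + ln (2 * ln q) by apply: lnM; rewrite posrE.
rewrite -[X in X * _](lnK (x := _)) ?posrE// -expRD ler_expR.
have -> : ln 'C(p - d, m)%:R = m%:R / 2 * (2 * ln q - 1 - ln (2 * ln q)) :> R.
  by rewrite eq; field; rewrite gt_eqF.
rewrite lnZ /chernoff_gap /Z.
suff : m%:R / 2 * 0 <= m%:R / 2 * (9 / 8 * (2 * ln q) - 1 - (ln (9 / 8) + ln (2 * ln q))
    - (2 * ln q - 1 - ln (2 * ln q)) - (8^-1 - ln (9 / 8))) by rewrite mulr0 !mulrBr; lra.
by rewrite ler_pM2l ?divr_gt0//; lra.
Qed.

Lemma failure_bound_cvg0 : failure_bound k @[k --> \oo] --> (0 : R).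
Proof.
have sqrt_oo : Num.sqrt (2 * ln k%:R) @[k --> \oo] --> (+oo : set_system R).
  apply/cvgryPge => M; near=> k.
  have Mk : expR (M ^+ 2) <= k%:R by near: k; exact: nbhs_infty_ger.
  have k0 : 0 < k%:R :> R by exact: lt_le_trans (expR_gt0 _) Mk.
  rewrite (le_trans (ler_norm M))// -sqrtr_sqr ler_wsqrtr//.
  have : M ^+ 2 <= ln k%:R by rewrite -ler_expR lnK ?posrE.
  by have := sqr_ge0 M; lra.
rewrite -[0](addr0 0) -[X in X + 0](mulr0 (4 * normal_peak 1)); apply: cvgD.
  apply: cvgM; first exact: cvg_cst.
  apply/(gtr0_cvgV0 _).2/sqrt_oo.
  near=> k; rewrite sqrtr_gt0 mulr_gt0// ln_natr_gt0//.
  by near: k; exact: nbhs_infty_gt.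
have gap4 : 0 < 4^-1 * chernoff_gap by rewrite mulr_gt0// chernoff_gap_gt0.
have lin : k%:R / 4 * chernoff_gap @[k --> \oo] --> (+oo : set_system R).
  under eq_fun do rewrite -mulrA.
  exact: (cvg_comp _ _ (@cvgr_idn R) (gt0_cvgMly gap4 (@cvg_id _ +oo%R))). 
exact: (cvg_comp _ _ lin (@cvgr_expR R)).
Unshelve. all: by end_near. Qed.
End Rates.

Section OracleError.
Context {R : realType} (n p : nat) (X : 'M[R]_(n, p)).
Context (d : nat) (clo chi : R) (A : {set 'I_p}).
Hypotheses (n_gt0 : (0 < n)%N) (clo_gt0 : 0 < clo).
Hypothesis src : sparse_eigen_bounds X d clo chi.
Hypothesis Ad : (#|A| <= d)%N.
Hypothesis hX : forall j, sqnorm (col j X) = n%:R.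

Let n0 : n%:R != 0 :> R. Proof. by rewrite pnatr_eq0 -lt0n. Qed.
(** Represents the coordinate j for [gdot] among the vectors supported by [A], so that the error of
    the oracle at j is a linear form in the noise. *)
Let a j : 'cV[R]_p := nsolve X A (delta_mx j 0).

Lemma dot_delta (j : 'I_p) (b : 'cV[R]_p) : dot (delta_mx j 0) b = b j 0.
Proof.
rewrite /dot (bigD1 j)//= big1 => [|k kj]; first by rewrite mxE !eqxx mul1r addr0.
by rewrite mxE (negbTE kj) mul0r.
Qed.

Lemma gdot_nsolve_delta j b : supported A b -> gdot X (a j) b = b j 0.
Proof. by move=> sb; rewrite (gdot_nsolve clo_gt0 src)// dot_delta. Qed.

Lemma oracle_error (b : 'cV[R]_p) (e : 'cV[R]_n) j : supported A b ->
  oracle_lse X (X *m b + e) A j 0 = b j 0 + dot (X *m a j) e / n%:R.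
Proof.
move=> sb; set y := _ + e.
have sa : supported A (a j) by exact: nsolve_supported.
rewrite (oracle_lseE n_gt0 clo_gt0 src)// -gdot_nsolve_delta; last exact: nsolve_supported.
rewrite gdotC (gdot_nsolve clo_gt0 src)// dotZl dotC -dot_mulmx mulrC dotDr mulrDl.
by congr (_ + _); rewrite -[RHS](gdot_nsolve_delta j sb).
Qed.

Lemma sqnorm_nsolve_delta j : sqnorm (X *m a j) = n%:R * a j j 0.
Proof.
rewrite -gdot_nsolve_delta ?gdot_sqnorm; last exact: nsolve_supported.
by rewrite mulrC divfK.
Qed.

Lemma sqnorm_nsolve_delta_le j : j \in A ->
  sqnorm (X *m a j) <= n%:R * max_diag_inv (gram X A).
Proof. by move=> jA; rewrite sqnorm_nsolve_delta ler_wpM2l// nsolve_delta_le. Qed.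

(** Cauchy-Schwarz for [a j] and the basis vector j, which has energy 1 by the normalization of the
    columns. It keeps the Gaussian scale of the entries on [A] positive. *)
Lemma max_diag_inv_ge1 : (0 < #|A|)%N -> 1 <= max_diag_inv (gram X A).
Proof.
move=> /card_gt0P[j jA]; apply: le_trans (nsolve_delta_le X jA).
have sd : supported A (delta_mx j 0 : 'cV[R]_p).
  by move=> k kA; rewrite mxE; case: eqP kA => // ->; rewrite jA.
have := gdot_sqr_le X (a j) (delta_mx j 0).
rewrite gdot_nsolve_delta// mxE !eqxx expr1n.
rewrite gdot_nsolve_delta; last exact: nsolve_supported.
by rewrite gdot_sqnorm -colE hX divff// mulr1.
Qed.

End OracleError.

Section FiniteSample.
Context {R : realType} (n p : nat) (X : 'M[R]_(n, p)) (beta : 'cV[R]_p).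
Context (d : nat) (sigma clo chi gamma q : R).
Local Notation A := (supp beta).
Local Notation wO := (max_diag_inv (gram X A)).
Local Notation luniv := (lambda_univ n p sigma).
Local Notation lpt := (2 * Num.sqrt chi * sigma * Num.sqrt (2 / n%:R * ln q)).
Hypotheses (n_gt0 : (0 < n)%N) (sigma_gt0 : 0 < sigma) (clo_gt0 : 0 < clo).
Hypothesis clo_chi : clo <= chi.
Hypothesis src : sparse_eigen_bounds X d clo chi.
Hypothesis hX : forall j, sqnorm (col j X) = n%:R.
Hypothesis hd : #|A|%:R <= d%:R / (chi / clo + 2^-1).
Hypothesis hgamma : clo^-1 * Num.sqrt (4 + clo / chi) <= gamma.
Hypothesis hpt : is_ptilde1 p #|A| (d - #|A|) q.
Hypothesis hbeta : sigma * Num.sqrt (wO * (2 / n%:R) * ln #|A|%:R) +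
  gamma * Num.max lpt luniv <= beta_min beta.
Hypothesis A_gt1 : (1 < #|A|)%N.

Let nR : 0 < n%:R :> R. Proof. by rewrite ltr0n. Qed.
Let chi_gt0 : 0 < chi. Proof. exact: lt_le_trans clo_chi. Qed.

Let card_lt : (#|A| < d)%N.
Proof. by have [/andP[m0 _] _ _] := hpt; rewrite -subn_gt0. Qed.

Let card_le : (#|A| <= d)%N. Proof. exact: ltnW. Qed.

Let card_supp_le : (#|A| <= p)%N.
Proof. by rewrite -[leqRHS]card_ord max_card. Qed.

Let sparsity : (chi / clo - 2^-1) * #|A|%:R <= (d - #|A|)%:R.
Proof.
have k0 : 0 < chi / clo by rewrite divr_gt0.
by move: hd; rewrite ler_pdivlMr ?addr_gt0 ?invr_gt0// natrB//; lra.
Qed.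

Lemma half_card_supp_le : #|A|%:R / 2 <= (d - #|A|)%:R :> R.
Proof.
apply: le_trans sparsity; rewrite mulrC ler_wpM2r//.
have : 1 <= chi / clo by rewrite ler_pdivlMr ?mul1r.
by lra.
Qed.

Let gamma_clo : 2 <= gamma * clo.
Proof.
rewrite mulrC -ler_pdivrMl//; apply: le_trans hgamma; rewrite ler_pM2l ?invr_gt0//.
have -> : 2 = Num.sqrt (2 ^+ 2) :> R by rewrite sqrtr_sqr ger0_norm.
by rewrite ler_wsqrtr// expr2 -natrM lerDl divr_ge0// ltW.
Qed.

Let gamma_gt0 : 0 < gamma.
Proof. by rewrite -(pmulr_lgt0 _ clo_gt0); exact: lt_le_trans gamma_clo. Qed.

Let p_gt1 : (1 < p)%N. Proof. exact: leq_trans card_supp_le. Qed.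

Let luniv_gt0 : 0 < luniv.
Proof. by rewrite mulr_gt0// sqrtr_gt0 mulr_gt0 ?divr_gt0// ln_natr_gt0. Qed.

Let ln_q_gt0 : 0 < ln q. Proof. by have := ptilde1_ge1 hpt; lra. Qed.

Let sqrt_div_n (x : R) : 0 <= x ->
  Num.sqrt (2 * x) * sigma * Num.sqrt n%:R / n%:R = sigma * Num.sqrt (2 / n%:R * x).
Proof.
move=> x0; have -> : 2 / n%:R * x = 2 * x / n%:R by rewrite mulrAC.
rewrite [in RHS]sqrtrM ?mulr_ge0// sqrtrV ?ler0n//.
set r := Num.sqrt n%:R; have -> : n%:R = r ^+ 2 :> R by rewrite sqr_sqrtr// ltW.
by field; rewrite gt_eqF// sqrtr_gt0.
Qed.

Lemma beta_min_le j : j \in A -> beta_min beta <= `|beta j 0|.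
Proof.
by move=> jA; apply: ge_inf; [exists 0 => _ [k _ <-]|exists j].
Qed.

Section GoodEvent.
Context (e : 'cV[R]_n) (lam : R -> R) (bhat : R -> 'cV[R]_p).
Local Notation y := (X *m beta + e).
Local Notation o := (oracle_lse X y A).
Hypothesis noise_out : forall j, j \notin A ->
  `|dot (X *m residual X A j) e| < Num.sqrt (2 * ln p%:R) * sigma * Num.sqrt n%:R.
Hypothesis noise_in : forall j, j \in A ->
  `|dot (X *m nsolve X A (delta_mx j 0)) e| <
  Num.sqrt (2 * ln #|A|%:R) * sigma * Num.sqrt (n%:R * wO).
Hypothesis noise_chi : forall B1 : {set 'I_p},
  (forall j, j \in A -> j \notin B1) -> #|B1| = (d - #|A|)%N ->
  exists us, [/\ orthonormal us, 
    forall z, supported (A :|: B1) z -> {in A, forall j, corr X z j 0 = 0} ->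
      expands us (X *m z) &
    \sum_(u <- us) dot u e ^+ 2 <= (d - #|A|)%:R * (9 / 8 * (2 * ln q)) * sigma ^+ 2].

Let supp_beta : supported A beta.
Proof. by move=> j; rewrite inE negbK => /eqP. Qed.

Let l2 := Num.max lpt luniv.

Let l2_ge0 : 0 <= l2. Proof. by rewrite le_max (ltW luniv_gt0) orbT. Qed.

Let score_lt j : j \notin A -> `|score X y o j| < luniv.
Proof.
move=> jA; rewrite (score_oracle_residual n_gt0 clo_gt0 src)// dotDr.
rewrite (dotX_orth n_gt0 (corr_residual clo_gt0 src card_le j))// add0r.
rewrite normrM normfV [X in _ / X]gtr0_norm// /lambda_univ -sqrt_div_n.
  by rewrite ltr_pM2r ?invr_gt0 ?noise_out.
exact/ltW/ln_natr_gt0.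
Qed.

Let error_lt j : j \in A ->
  `|o j 0 - beta j 0| < sigma * Num.sqrt (wO * (2 / n%:R) * ln #|A|%:R).
Proof.
move=> jA; rewrite (oracle_error n_gt0 clo_gt0 src card_le)// addrC addKr.
have w0 : 0 <= wO.
  by rewrite (le_trans ler01)// (max_diag_inv_ge1 _ clo_gt0 src)// ltnW.
have l0 : 0 <= ln #|A|%:R :> R by exact/ltW/ln_natr_gt0.
have -> : sigma * Num.sqrt (wO * (2 / n%:R) * ln #|A|%:R) =
    Num.sqrt (2 * ln #|A|%:R) * sigma * Num.sqrt (n%:R * wO) / n%:R.
  rewrite -mulrA sqrtrM// [X in _ = _ * X / _]sqrtrM ?ler0n// mulrA mulrAC.
  by rewrite -sqrt_div_n// mulrAC mulrA.
by rewrite normrM normfV [X in _ / X]gtr0_norm// ltr_pM2r ?invr_gt0 ?noise_in.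
Qed.

Let beta_ge j : j \in A ->
  sigma * Num.sqrt (wO * (2 / n%:R) * ln #|A|%:R) + gamma * l2 <= `|beta j 0|.
Proof. by move=> jA; exact: le_trans hbeta (beta_min_le jA). Qed.

Let oracle_ge j : j \in A -> gamma * l2 <= `|o j 0|.
Proof.
move=> jA; have := error_lt jA; have := beta_ge jA.
have := ler_normD (o j 0) (beta j 0 - o j 0).
rewrite addrC subrK distrC; move: (sigma * _) (gamma * _) => u v.
by lra.
Qed.

Lemma oracle_sgn : sgn o = sgn beta.
Proof.
apply/matrixP => j k; rewrite ord1 !mxE; have [jA|jA] := boolP (j \in A); last first.
  rewrite supp_beta// (oracle_lseE n_gt0 clo_gt0 src)//.
  by rewrite (nsolve_supported _ _ jA).
have := error_lt jA; have := beta_ge jA; have := mulr_ge0 (ltW gamma_gt0) l2_ge0.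
move: (sigma * _) (gamma * _) (o j 0) (beta j 0) => u v x b v0 ub xb.
have [b0|b0|b0] := ltgtP b 0; last by move: ub; rewrite b0 normr0; have := normr_ge0 (x - b); lra.
  by rewrite (ltr0_sg b0) ltr0_sg//; move: ub xb; rewrite ltr0_norm// ltr_norml => ub /andP[]; lra.
by rewrite (gtr0_sg b0) gtr0_sg//; move: ub xb; rewrite gtr0_norm// ltr_norml => ub /andP[]; lra.
Qed.

Lemma good_event : solution_path X y gamma lam bhat -> selector lam bhat luniv = o.
Proof.
(* The inflated chi-square level over n. As the first level in [l2] has square 8 chi sigma^2 ln q /
   n, [E * chi] is 9/8 * 1/4 = 9/32 of m times that square. *)
pose E := (d - #|A|)%:R * (9 / 8 * (2 * ln q)) * sigma ^+ 2 / n%:R.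
apply: (selector_oracle (l2 := l2) (E := E) n_gt0 clo_gt0 clo_chi src gamma_clo
  card_lt sparsity) => //.
- by rewrite le_max lexx orbT.
- by rewrite !mulr_ge0 ?invr_ge0 ?ler0n ?sqr_ge0// ltW.
- have lpt2 : lpt ^+ 2 = 4 * chi * sigma ^+ 2 * (2 / n%:R * ln q).
    rewrite !exprMn !sqr_sqrtr ?(ltW chi_gt0)//; first by ring.
    by rewrite mulr_ge0 ?divr_ge0 ?ler0n// ltW.
  have lpt0 : 0 <= lpt by rewrite !mulr_ge0 ?sqrtr_ge0 ?(ltW sigma_gt0).
  have -> : E * chi = 9 / 32 * ((d - #|A|)%:R * lpt ^+ 2).
    by rewrite lpt2 /E; field; rewrite gt_eqF.
  rewrite ler_wpM2l ?divr_ge0// ler_wpM2l ?ler0n// ler_pXn2r ?nnegrE//.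
  by rewrite le_max lexx.
move=> B1 AB1 cB1 z sz zA; have [us [us_on us_z us_le]] := noise_chi AB1 cB1.
rewrite dotDr (dotX_orth n_gt0 zA supp_beta) add0r gdot_sqnorm expr_div_n /E.
rewrite mulrACA -expr2 -exprVn ler_wpM2r ?exprn_ge0 ?invr_ge0 ?ler0n// [leRHS]mulrC.
apply: (le_trans (dot_sqr_le_coords e us_on (us_z z sz zA))).
by rewrite ler_wpM2l// sqnorm_ge0.
Qed.

End GoodEvent.

Context (disp : measure_display) (T : measurableType disp) (P : probability T R).
Context (eps : 'I_n -> {RV P >-> R}).
Hypothesis noise : gaussian_noise sigma eps.
Local Notation y := (response X beta eps).
Local Notation comb := (combination eps).

Let measurable_comb_ge (c : R) (u : 'cV[R]_n) :
  measurable [set w | c <= `|comb u w|].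
Proof.
rewrite -[X in measurable X]setTI.
exact: (measurable_combination eps u measurableT (measurable_norm_ge c)).
Qed.

Let measurable_chi_ge (c : R) (us : seq 'cV[R]_n) :
  measurable [set w | c <= \sum_(u <- us) comb u w ^+ 2].
Proof.
have ms : measurable_fun [set: T] (fun w => \sum_(u <- us) comb u w ^+ 2).
  by apply: measurable_sum => u; apply: measurable_funX; exact: measurable_combination.
by rewrite -[X in measurable X]setTI; exact: (ms measurableT _ (measurable_ge_set _)).
Qed.

Let tail_union (I : finType) (B : {set I}) (u : I -> 'cV[R]_n) (r : R) (k : nat) :
  (1 < k)%N -> (#|B| <= k)%N -> 0 < r -> {in B, forall i, sqnorm (u i) <= r ^+ 2} ->
  exists U, [/\ measurable U,
    forall w i, ~ U w -> i \in B ->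
      `|dot (u i) (\col_l eps l w)| < Num.sqrt (2 * ln k%:R) * sigma * r &
    (P U <= (2 * normal_peak 1 / Num.sqrt (2 * ln k%:R))%:E)%E].
Proof.
move=> k1 Bk r0 ur; pose x := Num.sqrt (2 * ln k%:R) : R.
have x0 : 0 < x by rewrite sqrtr_gt0 mulr_gt0// ln_natr_gt0.
pose c := 2 * normal_peak 1 / x * expR (- x ^+ 2 / 2).
have c0 : 0 <= c by rewrite !mulr_ge0 ?normal_peak_ge0 ?expR_ge0// invr_ge0 ltW.
have [U [mU EU PU]] : exists U, [/\ measurable U,
    {in enum B, forall i, [set w | x * sigma * r <= `|comb (u i) w|] `<=` U} &
    (P U <= ((size (enum B))%:R * c)%:E)%E].
  apply: union_bound => // i; rewrite mem_enum => iB; split.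
    exact: measurable_comb_ge.
  exact: (combination_tail sigma_gt0 noise r0 x0 (ur _ iB)).
exists U; split=> // [w i Uw iB|].
  rewrite ltNge; apply/negP => ge; apply: Uw; apply: (EU i); first by rewrite mem_enum.
  by rewrite /= combination_dot.
by apply: (le_trans PU); rewrite lee_fin -cardE gaussian_union_le.
Qed.

Let chi_union : exists U, [/\ measurable U,
  forall w, ~ U w -> forall B1 : {set 'I_p},
    (forall j, j \in A -> j \notin B1) -> #|B1| = (d - #|A|)%N ->
    exists us, [/\ orthonormal us,
      forall z, supported (A :|: B1) z -> {in A, forall j, corr X z j 0 = 0} ->
        expands us (X *m z) &
      \sum_(u <- us) dot u (\col_l eps l w) ^+ 2 <=
        (d - #|A|)%:R * (9 / 8 * (2 * ln q)) * sigma ^+ 2] &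
  (P U <= (expR (- ((d - #|A|)%:R / 2 * chernoff_gap)))%:E)%E].
Proof.
pose m := (d - #|A|)%N; pose Z := 9 / 8 * (2 * ln q).
have Z1 : 1 <= Z by have := ptilde1_ge1 hpt; rewrite /Z; lra.
(* The tail bound is for deterministic vectors, so a basis is fixed for every [B1] before the noise;
   a set meeting [A] gets the empty list. *)
have us_ex (B1 : {set 'I_p}) : exists us : seq 'cV[R]_n,
    (forall j, j \in A -> j \notin B1) -> [/\ (size us <= #|B1|)%N, orthonormal us &
    forall z, supported (A :|: B1) z -> {in A, forall j, corr X z j 0 = 0} ->
      expands us (X *m z)].
  have [AB1|AB1] := pselect (forall j, j \in A -> j \notin B1); last by exists [::] => /AB1.
  by have [us usP] := residual_basis clo_gt0 src card_le AB1; exists us.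
have [us usP] := boolp.choice us_ex.
pose Bs := [set B1 : {set 'I_p} | B1 \subset ~: A & #|B1| == m]%SET.
have outA (B1 : {set 'I_p}) : B1 \subset (~: A)%SET <-> forall j, j \in A -> j \notin B1.
  split=> [/fintype.subsetP BA j jA|H].
    by apply/negP => /BA; rewrite inE jA.
  by apply/fintype.subsetP => j jB; rewrite inE; apply: contraL jB => /H.
pose c := expR (- (m%:R / 2 * (Z - 1 - ln Z))).
have [U [mU EU PU]] : exists U, [/\ measurable U,
    {in enum Bs, forall B1, [set w | m%:R * Z * sigma ^+ 2 <=
       \sum_(u <- us B1) comb u w ^+ 2] `<=` U} &
    (P U <= ((size (enum Bs))%:R * c)%:E)%E].
  apply: union_bound => [|B1]; first exact: expR_ge0.
  rewrite mem_enum inE => /andP[/outA AB1 /eqP cB1].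
  have [us_size /andP[us_orth us_unit] _] := usP B1 AB1.
  split; first exact: measurable_chi_ge.
  by apply: (chi_square_tail sigma_gt0 noise) => //; rewrite -?cB1.
exists U; split=> // [w Uw B1 AB1 cB1|].
  have [_ us_on us_z] := usP B1 AB1; exists (us B1); split=> //.
  rewrite leNgt; apply/negP => lt; apply: Uw; apply: (EU B1).
    by rewrite mem_enum inE cB1 eqxx andbT; apply/outA.
  rewrite /=; under eq_bigr do rewrite combination_dot.
  exact: ltW.
apply: (le_trans PU); rewrite lee_fin -cardE cards_draws.
by rewrite cardsCs finset.setCK card_ord; exact: ptilde1_union_le hpt.
Qed.

(** One [U] serves all paths at once: [lam] and [bhat] are quantified after it. *)
Lemma failure_event : exists U, [/\ measurable U,
  (P U <= (failure_bound #|A|)%:E)%E &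
  forall w lam bhat, ~ U w -> solution_path X (y w) gamma lam bhat ->
    selector lam bhat luniv = oracle_lse X (y w) A /\
    sgn (selector lam bhat luniv) = sgn beta].
Proof.
have A_gt0 : (0 < #|A|)%N by exact: ltnW.
have w0 : 0 < wO.
  by rewrite (lt_le_trans ltr01)// (max_diag_inv_ge1 n_gt0 clo_gt0 src).
have cardC : (#|~: A| <= p)%N by rewrite -[leqRHS]card_ord max_card.
have r1 : 0 < Num.sqrt n%:R :> R by rewrite sqrtr_gt0.
have r2 : 0 < Num.sqrt (n%:R * wO) by rewrite sqrtr_gt0 mulr_gt0.
have [|U1 [mU1 U1P PU1]] := tail_union (u := fun j => X *m residual X A j) p_gt1 cardC r1.
  move=> j _; rewrite sqr_sqrtr ?ler0n// -(hX j).
  exact: (sqnorm_residual_le n_gt0 clo_gt0 src card_le).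
have [|U2 [mU2 U2P PU2]] := tail_union
    (u := fun j => X *m nsolve X A (delta_mx j 0)) A_gt1 (leqnn _) r2.
  move=> j jA; rewrite sqr_sqrtr ?mulr_ge0 ?ler0n// ?(ltW w0)//.
  exact: (sqnorm_nsolve_delta_le n_gt0 clo_gt0 src card_le).
have [U3 [mU3 U3P PU3]] := chi_union.
exists (U1 `|` U2 `|` U3); split; first by do 2 apply: measurableU => //.
- have le1 : (P (U1 `|` U2 `|` U3) <= P U1 + P U2 + P U3)%E.
    apply: (le_trans (measureU2 P (measurableU _ _ mU1 mU2) mU3)).
    by rewrite leeD2r// measureU2.
  apply: (le_trans le1); apply: (le_trans (leeD (leeD PU1 PU2) PU3)).
  rewrite -!EFinD lee_fin /failure_bound lerD//; last first.
    (* The rate #|A| / 4 comes from m >= #|A| / 2. *)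
    rewrite ler_expR lerN2 ler_wpM2r ?(ltW chernoff_gap_gt0)//.
    by have := half_card_supp_le; lra.
  have peak0 : 0 <= 2 * normal_peak 1 :> R by rewrite mulr_ge0// normal_peak_ge0.
  have -> : 4 * normal_peak 1 / Num.sqrt (2 * ln #|A|%:R) =
      2 * normal_peak 1 / Num.sqrt (2 * ln #|A|%:R) +
      2 * normal_peak 1 / Num.sqrt (2 * ln #|A|%:R) :> R by ring.
  (* The scores contribute a term in ln p and the entries one in ln #|A|; as #|A| <= p, the second
     dominates. *)
  have lA := ln_natr_gt0 (R := R) A_gt1.
  rewrite lerD2r ler_wpM2l// lef_pV2 ?posrE ?sqrtr_gt0 ?mulr_gt0 ?ln_natr_gt0//.
  by rewrite ler_wsqrtr// ler_wpM2l// ler_ln ?posrE ?ltr0n ?ler_nat// ltnW.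
move=> w lam bhat U path.
have nU1 : ~ U1 w by move=> h; apply: U; left; left.
have nU2 : ~ U2 w by move=> h; apply: U; left; right.
have nU3 : ~ U3 w by move=> h; apply: U; right.
have out j : j \notin A -> `|dot (X *m residual X A j) (\col_l eps l w)| <
    Num.sqrt (2 * ln p%:R) * sigma * Num.sqrt n%:R.
  by move=> jA; apply: U1P => //; rewrite inE.
have inA j (jA : j \in A) := U2P w j nU2 jA.
rewrite (good_event out inA (U3P w nU3) path); split=> //.
exact: oracle_sgn inA.
Qed.

End FiniteSample.

(** * The asymptotic statement *)

Theorem corollary1 (R : realType)
  (disp : nat -> measure_display)
  (T : forall n, measurableType (disp n))
  (P : forall n, probability (T n) R)
  (p : nat -> nat)
  (X : forall n, 'M[R]_(n, p n))
  (beta : forall n, 'cV[R]_(p n))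
  (sigma : nat -> R)
  (eps : forall n, 'I_n -> {RV (P n) >-> R})
  (dstar : nat -> nat)
  (clo chi gamma pt1 : nat -> R)
  (lam : forall n, T n -> R -> R)
  (bhat : forall n, T n -> R -> 'cV[R]_(p n))
  (dO := fun n => #|supp (beta n)|)
  (wO := fun n => max_diag_inv (gram (X n) (supp (beta n))))
  (luniv := fun n => lambda_univ n (p n) (sigma n))
  (y := fun n => response (X n) (beta n) (@eps n))
  (hX : \forall n \near \oo, forall j, sqnorm (col j (X n)) = n%:R)
  (hsigma : \forall n \near \oo, 0 < sigma n)
  (heps : \forall n \near \oo, gaussian_noise (sigma n) (@eps n))
  (hdstar : \forall n \near \oo, (0 < dstar n)%N)
  (hc : \forall n \near \oo, 0 < clo n <= chi n)
  (hSRC : \forall n \near \oo,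
     sparse_eigen_bounds (X n) (dstar n) (clo n) (chi n))
  (hd : \forall n \near \oo,
     (dO n)%:R <= (dstar n)%:R / (chi n / clo n + 2^-1))
  (hdO : dO n @[n --> \oo] --> \oo)
  (hgamma : \forall n \near \oo,
     (clo n)^-1 * Num.sqrt (4 + clo n / chi n) <= gamma n)
  (hpt1 : \forall n \near \oo,
     is_ptilde1 (p n) (dO n) (dstar n - dO n) (pt1 n))
  (hbeta : \forall n \near \oo,
     sigma n * Num.sqrt (wO n * (2 / n%:R) * ln (dO n)%:R)
       + gamma n * Num.max
           (2 * Num.sqrt (chi n) * sigma n * Num.sqrt (2 / n%:R * ln (pt1 n)))
           (luniv n)
     <= beta_min (beta n))
  (hpath : \forall n \near \oo, {ae P n, forall w,
     solution_path (X n) (y n w) (gamma n) (@lam n w) (@bhat n w)}) :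
  (mu_ext (P n)
     [set w | selector (@lam n w) (@bhat n w) (luniv n)
                <> oracle_lse (X n) (y n w) (supp (beta n))
           \/ sgn (selector (@lam n w) (@bhat n w) (luniv n))
                <> sgn (beta n)])%E
    @[n --> \oo] --> 0%E.
Proof.
apply: (squeeze_cvge (f := fun=> 0%E) (h := fun n => (failure_bound (dO n))%:E)); last 2 first.
- exact: cvg_cst.
- apply: cvg_EFin; first exact: nearW.
  exact: (cvg_comp _ _ hdO (@failure_bound_cvg0 R)).
near=> n.
apply/andP; split; first exact: mu_ext_ge0.
have n_gt0 : (0 < n)%N by near: n; exact: nbhs_infty_gt.
have A_gt1 : (1 < dO n)%N.
  by near: n; move/cvgnyPgt : hdO; exact.
have /andP[clo0 clochi] : 0 < clo n <= chi n by near: n.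
have [U [mU PU UP]] : exists U, [/\ measurable U,
  (P n U <= (failure_bound (dO n))%:E)%E &
  forall w l b, ~ U w -> solution_path (X n) (y n w) (gamma n) l b ->
    selector l b (luniv n) = oracle_lse (X n) (y n w) (supp (beta n)) /\
    sgn (selector l b (luniv n)) = sgn (beta n)].
  apply: (@failure_event R n (p n) (X n) (beta n) (dstar n) (sigma n) (clo n)
    (chi n) (gamma n) (pt1 n)) => //; by near: n.
have [N [mN PN Npath]] : {ae P n, forall w,
    solution_path (X n) (y n w) (gamma n) (@lam n w) (@bhat n w)} by near: n.
(* The failure set may fail to be measurable, hence the outer measure; it is covered by [U] and by
   the null set [N] outside which the path is a solution path. *)
apply: (@le_trans _ _ (mu_ext (P n) (U `|` N))).
  apply: le_mu_ext => w /= fail; apply: contrapT => /not_orP[nU nN].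
  have path : solution_path (X n) (y n w) (gamma n) (@lam n w) (@bhat n w).
    by apply: contrapT => np; apply: nN; exact: Npath.
  by have [E1 E2] := UP w _ _ nU path; case: fail.
rewrite measurable_mu_extE; last exact: measurableU.
apply: (le_trans (measureU2 (P n) mU mN)).
have PN0 : (P n N <= 0)%E by rewrite -[leRHS]PN.
by apply: (le_trans (leeD PU PN0)); rewrite adde0.
Unshelve. all: by end_near. Qed.
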